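(* Let $n, l_1, l_2, \dots, l_n$ be positive integers and let $U$ be an open set of $\mathbb{C}^{l_1}\times\mathbb{C}^{l_2}\times\cdots\times\mathbb{C}^{l_n}$. Then the following conditions are equivalent: (a) $U$ is a domain of $\mathbb{C}^n$-existence; (b) $U$ is a domain of $\mathbb{C}^n$-holomorphy; (c) $U$ is $\mathbb{C}^n$-holomorphically convex.
   Context: Write $X=\mathbb{C}^{l_1}\times\cdots\times\mathbb{C}^{l_n}$ with points $z=(z_1,\dots,z_n)$, $z_j\in\mathbb{C}^{l_j}$. For $w_1,\dots,w_m\in\mathbb{C}$, $|(w_1,\dots,w_m)|$ denotes $\max_{k}|w_k|$ (used both on $X$ and on $\mathbb{C}^n$). $\mathbb{C}^n$-holomorphic functions: for an open set $U\subset X$, a map $f=(f_1,\dots,f_n):U\to\mathbb{C}^n$ (each $f_i$ complex-valued) is $\mathbb{C}^n$-holomorphic if $f$ is holomorphic and for every $a\in U$ and all $i\neq j$ in $\{1,\dots,n\}$, $\frac{\partial f_i}{\partial z_j}(a)=0$ (i.e. all partial derivatives of $f_i$ with respect to the coordinates of $z_j\in\mathbb{C}^{l_j}$ vanish at $a$). $O_{l_1,\dots,l_n}(U)$ denotes the set of all $\mathbb{C}^n$-valued $\mathbb{C}^n$-holomorphic functions on $U$. Domain of $\mathbb{C}^n$-existence: an open $U\subset X$ such that there exists $f\in O_{l_1,\dots,l_n}(U)$ such that for all open sets $V,W\subset X$ with $V$ connected, $V\setminus U\neq\emptyset$ and $\emptyset\neq W\subset U\cap V$, and for every $g\in O_{l_1,\dots,l_n}(V)$,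 one has $f|_W\neq g|_W$. Domain of $\mathbb{C}^n$-holomorphy: an open $U\subset X$ such that for all open sets $V,W\subset X$ with $V$ connected, $V\setminus U\neq\emptyset$ and $\emptyset\neq W\subset U\cap V$, there exists $f\in O_{l_1,\dots,l_n}(U)$ such that for every $g\in O_{l_1,\dots,l_n}(V)$ one has $f|_W\neq g|_W$. $\mathbb{C}^n$-holomorphically convex hull: for $K\subset U$ compact, $\widehat{K}^U_{l_1,\dots,l_n}=\{z\in U : \forall f\in O_{l_1,\dots,l_n}(U),\ |f(z)|\le\sup_{w\in K}|f(w)|\}$. $U$ is $\mathbb{C}^n$-holomorphically convex if $\widehat{K}^U_{l_1,\dots,l_n}$ is compact for every compact $K\subset U$. *)

(* Defs.v *)
From HB Require Import structures.
From mathcomp Require Import all_boot all_order all_algebra.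
From mathcomp Require Import complex.
From mathcomp Require Import all_classical all_reals all_analysis.

Set Implicit Arguments.
Unset Strict Implicit.
Unset Printing Implicit Defensive.

Import Order.TTheory GRing.Theory Num.Theory.
Import numFieldNormedType.Exports.

Local Open Scope classical_set_scope.
Local Open Scope ring_scope.

(* The standard normed-module structure of a numFieldType over itself, declared
   on R[i] so that the type itself carries its usual topology. *)
Section ComplexNormedModule.
Variable R : rcfType.
HB.instance Definition _ := GRing.ComAlgebra.copy R[i] R[i]^o.
HB.instance Definition _ := Vector.copy R[i] R[i]^o.
HB.instance Definition _ := NormedModule.copy R[i] R[i]^o.
End ComplexNormedModule.

Section CnHolomorphy.
Context {R : realType} {n : nat}.

(* C^{l_1} x ... x C^{l_n} as row vectors cut into n blocks: the block z_j is
   [submxrow z j], and its k-th coordinate is the entry [tagnat.Rank j k] of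
   z.  The norm of a row vector is the maximum of the moduli of its entries. *)
Definition blockspace (l : 'I_n -> nat) := 'rV[R[i]]_(\sum_(j < n) l j).

Definition Cspace := 'rV[R[i]]_n.

Implicit Types (l : 'I_n -> nat).

Definition partial l (h : blockspace l -> R[i]) (j : 'I_n) (k : 'I_(l j))
    (a : blockspace l) : R[i] :=
  'D_(delta_mx 0 (@tagnat.Rank n l j k)) h a.

(* Functions on U are total functions of which only the values on U matter:
   as U is open, differentiability and partial derivatives at the points of U
   depend only on these values.  [differentiable] is over the field R[i], so it
   is complex (Frechet) differentiability. *)
Definition Cn_holomorphic l (U : set (blockspace l))
    (f : blockspace l -> Cspace) : Prop :=
  (forall a, U a -> differentiable f a) /\
  (forall a, U a -> forall i j : 'I_n, i != j -> forall k : 'I_(l j),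
     partial (fun z => f z 0 i) k a = 0).

Definition domain_of_Cn_existence l (U : set (blockspace l)) : Prop :=
  open U /\
  exists2 f, Cn_holomorphic U f &
    forall V W : set (blockspace l), open V -> open W -> connected V ->
      V `\` U !=set0 -> W !=set0 -> W `<=` U `&` V ->
      forall g, Cn_holomorphic V g -> ~ (forall z, W z -> f z = g z).

Definition domain_of_Cn_holomorphy l (U : set (blockspace l)) : Prop :=
  open U /\
  forall V W : set (blockspace l), open V -> open W -> connected V ->
    V `\` U !=set0 -> W !=set0 -> W `<=` U `&` V ->
    exists2 f, Cn_holomorphic U f &
      forall g, Cn_holomorphic V g -> ~ (forall z, W z -> f z = g z).

(* The library norm of a complex vector is a nonnegative real element of R[i];
   this is the same number in R, where suprema are available. *)
Definition rnorm (w : Cspace) : R := complex.Re `|w|.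

(* In the hull, K is compact and f continuous on K, so the supremum is that of
   a bounded set; for K empty it is 0, and the hull is empty because the
   constant functions are C^n-holomorphic. *)
Definition Cn_hull l (U K : set (blockspace l)) : set (blockspace l) :=
  [set z | U z /\ forall f, Cn_holomorphic U f ->
             rnorm (f z) <= sup [set rnorm (f w) | w in K]].

Definition Cn_holomorphically_convex l (U : set (blockspace l)) : Prop :=
  forall K, compact K -> K `<=` U -> compact (Cn_hull U K).

End CnHolomorphy.

(* Main.v *)
Require Import Defs.
From HB Require Import structures.
From mathcomp Require Import all_boot all_order all_algebra.
From mathcomp Require Import complex.
From mathcomp Require Import all_classical all_reals all_analysis.
From mathcomp Require Import ring lra.

(* Each component of a C^n-holomorphic map is a holomorphic function killed by
   the derivatives along the other blocks, a property inherited by sums,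
   products, directional derivatives and locally uniform limits; the argument of
   Cartan and Thullen then applies componentwise.

   If a is in the hull of K and the closed r-neighbourhood of K lies in U, the
   Cauchy estimates on K bound the iterated directional derivatives at a of every
   function on U, so that its expansion at a into homogeneous polynomials
   converges on a ball around a of radius c r, where c is a universal constant.
   On a domain of C^n-holomorphy this ball has to lie in U, hence the hull is
   compact.

   Conversely, on a C^n-holomorphically convex U one builds a sum of functions,
   each of them small on a compact set of an exhaustion and large at a point
   outside its hull, which is unbounded on the largest ball contained in U around
   every point of a countable dense subset of U; by the identity theorem no
   function continues it across the boundary.

   Goursat's theorem gives the estimate |f'(0)| <= 100 M / r. Applied to f, and then
   to the increments of f, it yields a second-order Taylor estimate, which is
   stable under uniform limits; so limits of holomorphic functions, and
   derivatives as limits of difference quotients, are holomorphic. *)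

Set Implicit Arguments.
Unset Strict Implicit.
Unset Printing Implicit Defensive.

Import Order.TTheory GRing.Theory Num.Theory.
Import numFieldNormedType.Exports.

Local Open Scope classical_set_scope.
Local Open Scope ring_scope.
Local Open Scope complex_scope.

(** * The real-valued norm *)

(** The one-variable constants are far from sharp, so the ball found around a hull point is smaller
    by a fixed factor than in the classical equality of distances. A fixed factor suffices: since it
    depends neither on K, nor on a, nor on the function, a limit of hull points lies in one of these
    balls, hence in U. Directional derivatives keep all estimates on complex lines. Differentiating
    k times in k steps of length r / k costs (100 k |v| / r)^k, and k^k <= e^k k! turns the Taylor
    terms into a geometric series of ratio 100 e |v| / r. The price is a separate proof that the
    homogeneous terms are holomorphic in v. For the converse, V is an arbitrary connected open set
    and may meet U in many pieces, so that agreement with f on W spreads only over some of them. The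
    function must therefore be unbounded near the boundary as seen from every piece, which is why
    the balls are centred at the points of a dense set. *)

Section RealNorm.
Context {R : realType}.
Implicit Types V W : normedModType R[i].

(* The norm of a normed module over R[i] takes its values in R[i]. *)
Definition rn V (x : V) : R := complex.Re `|x|.

Lemma normE V (x : V) : `|x| = (rn x)%:C.
Proof. by rewrite /rn RRe_real // ger0_real. Qed.

Lemma rn_ge0 V (x : V) : 0 <= rn x.
Proof. by have := normr_ge0 x; rewrite normE -(ler0c (rn x)). Qed.

Lemma rn_def V (x : V) (r : R) : `|x| = r%:C -> rn x = r.
Proof. by rewrite /rn => ->. Qed.

Lemma rn0 V : rn (0 : V) = 0.
Proof. by rewrite /rn normr0. Qed.

Lemma rnN V (x : V) : rn (- x) = rn x.
Proof. by rewrite /rn normrN. Qed.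

Lemma rnB V (x y : V) : rn (x - y) = rn (y - x).
Proof. by rewrite /rn distrC. Qed.

Lemma rnD V (x y : V) : rn (x + y) <= rn x + rn y.
Proof. by rewrite -lecR rmorphD /= -!normE ler_normD. Qed.

Lemma rn_tri V (x y z : V) : rn (x - z) <= rn (x - y) + rn (y - z).
Proof. by have := rnD (x - y) (y - z); rewrite addrA subrK. Qed.

Lemma rnZ V (a : R[i]) (x : V) : rn (a *: x) = rn a * rn x.
Proof. by apply: rn_def; rewrite normrZ !normE -rmorphM. Qed.

Lemma rnM (a b : R[i]) : rn (a * b) = rn a * rn b.
Proof. by apply: rn_def; rewrite normrM !normE -rmorphM. Qed.

Lemma rnX (a : R[i]) k : rn (a ^+ k) = rn a ^+ k.
Proof. by apply: rn_def; rewrite normrX !normE -rmorphXn. Qed.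

Lemma rnV (a : R[i]) : rn a^-1 = (rn a)^-1.
Proof. by apply: rn_def; rewrite normfV normE -fmorphV. Qed.

Lemma rn_real (x : R) : rn x%:C = `|x|.
Proof.
apply: rn_def; rewrite normc_def /= expr0n /= addr0 sqrtr_sqr.
by [].
Qed.

Lemma rn_nat k : rn (k%:R : R[i]) = k%:R.
Proof. by rewrite /rn normr_nat -(rmorph_nat (real_complex R)). Qed.

Lemma rn_i : rn ('i : R[i]) = 1.
Proof. by rewrite /rn normc_def /= expr0n add0r expr1n sqrtr1. Qed.

Lemma rn_eq0 V (x : V) : rn x = 0 -> x = 0.
Proof. by move=> h; apply/eqP; rewrite -normr_eq0 normE h. Qed.

Lemma rn_gt0 V (x : V) : x != 0 -> 0 < rn x.
Proof.
move=> x0; rewrite lt_neqAle rn_ge0 andbT eq_sym.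
by apply: contra_neq x0 => /rn_eq0.
Qed.

Lemma rn_le_ReIm (z : R[i]) :
  rn z <= `|complex.Re z| + `|complex.Im z|.
Proof.
rewrite {1}[z]complexE; apply: le_trans (rnD _ _) _.
by rewrite rnM rn_i mul1r !rn_real.
Qed.

Lemma Re_le_rn (z : R[i]) : `|complex.Re z| <= rn z.
Proof.
by rewrite /rn normc_def /= -sqrtr_sqr ler_wsqrtr// lerDl sqr_ge0.
Qed.

Lemma Im_le_rn (z : R[i]) : `|complex.Im z| <= rn z.
Proof.
by rewrite /rn normc_def /= -sqrtr_sqr ler_wsqrtr// lerDr sqr_ge0.
Qed.

Lemma nbhs_rnP V (a : V) (P : set V) :
  nbhs a P <-> exists2 e : R, 0 < e & forall x, rn (x - a) < e -> P x.
Proof.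
split.
  move=> /nbhs_normP[e /= e0 h].
  have er : e = (complex.Re e)%:C by rewrite RRe_real // gtr0_real.
  exists (complex.Re e); first by rewrite -ltcR -er.
  by move=> x xa; apply: h; rewrite /ball_ /= distrC normE er ltcR.
move=> [e e0 h]; apply/nbhs_normP; exists e%:C => /=; first by rewrite ltcR.
by move=> x; rewrite /ball_ /= distrC normE ltcR; exact: h.
Qed.

Definition rnball V (a : V) (r : R) : set V := [set x | rn (x - a) < r].

Lemma rnball_center V (a : V) r : 0 < r -> rnball a r a.
Proof. by rewrite /rnball /= subrr rn0. Qed.

Lemma rnball_sub V (a b : V) r s : rn (b - a) + s <= r -> rnball b s `<=` rnball a r.
Proof.
rewrite /rnball => h x /= xb; apply: le_lt_trans (rn_tri _ b _) _.
by apply: lt_le_trans h; rewrite addrC ltrD2l.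
Qed.

Lemma open_rnball V (a : V) r : open (rnball a r).
Proof.
rewrite openE => x /= xa; apply/nbhs_rnP.
exists (r - rn (x - a)); first by rewrite subr_gt0.
by apply: (@rnball_sub _ a x r _); rewrite addrC subrK.
Qed.

Lemma open_rnP V (U : set V) : open U ->
  forall a, U a -> exists2 e : R, 0 < e & rnball a e `<=` U.
Proof. by rewrite openE => h a /h /nbhs_rnP. Qed.

Lemma nbhs_rnball V (a : V) r : 0 < r -> nbhs a (rnball a r).
Proof. by move=> r0; apply/nbhs_rnP; exists r. Qed.

Lemma cvg_rnP (T : Type) (F : set_system T) {FF : Filter F} V (f : T -> V) (y : V) :
  f @ F --> y <-> forall e : R, 0 < e -> \forall x \near F, rn (f x - y) < e.
Proof.
split.
  move=> h e e0; have /h : nbhs y (rnball y e) by apply: nbhs_rnball.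
  by [].
move=> h P /nbhs_rnP[e e0 hP]; apply: filterS (h e e0) => x; exact: hP.
Qed.

Lemma continuous_rnP V W (f : V -> W) (z : V) : {for z, continuous f} <->
  forall e : R, 0 < e -> exists2 r : R, 0 < r &
    forall w, rn (w - z) < r -> rn (f w - f z) < e.
Proof.
have -> : {for z, continuous f} <-> f @ nbhs z --> f z by [].
rewrite cvg_rnP; split=> h e e0.
  by have /nbhs_rnP := h e e0.
by apply/nbhs_rnP; exact: h.
Qed.

End RealNorm.

(** * Integrals of complex functions on real intervals *)

Section ComplexIntegral.
Context {R : realType}.
Implicit Types (F G : R -> R[i]) (a b c x : R).
Local Notation mu := (@lebesgue_measure R).
Local Notation Re := (@complex.Re R).
Local Notation Im := (@complex.Im R).

Lemma ReB (z w : R[i]) : Re (z - w) = Re z - Re w.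
Proof. by case: z; case: w. Qed.

Lemma ImB (z w : R[i]) : Im (z - w) = Im z - Im w.
Proof. by case: z; case: w. Qed.

Definition ccont a b F := forall x, a <= x <= b -> {for x, continuous F}.

Lemma for_continuous_Re F x : {for x, continuous F} ->
  {for x, continuous (Re \o F)}.
Proof.
move=> /cvg_rnP h; apply/cvgrPdist_lt => e e0; apply: filterS (h e e0) => y.
apply: le_lt_trans; rewrite distrC /= -ReB; exact: Re_le_rn.
Qed.

Lemma for_continuous_Im F x : {for x, continuous F} ->
  {for x, continuous (Im \o F)}.
Proof.
move=> /cvg_rnP h; apply/cvgrPdist_lt => e e0; apply: filterS (h e e0) => y.
apply: le_lt_trans; rewrite distrC /= -ImB; exact: Im_le_rn.
Qed.

Lemma for_continuous_integrable (f : R -> R) a b :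
  (forall x, a <= x <= b -> {for x, continuous f}) ->
  mu.-integrable `[a, b] (EFin \o f).
Proof.
move=> cf; apply: continuous_compact_integrable; first exact: segment_compact.
apply: continuous_in_subspaceT => x /set_mem /=; rewrite in_itv /=; exact: cf.
Qed.

Lemma ccont_Re a b F : ccont a b F -> mu.-integrable `[a, b] (EFin \o (Re \o F)).
Proof.
by move=> h; apply: for_continuous_integrable => x /h; exact: for_continuous_Re.
Qed.

Lemma ccont_Im a b F : ccont a b F -> mu.-integrable `[a, b] (EFin \o (Im \o F)).
Proof.
by move=> h; apply: for_continuous_integrable => x /h; exact: for_continuous_Im.
Qed.

Definition cint a b F : R[i] :=
  (\int[mu]_(x in `[a, b]) Re (F x)) +i* (\int[mu]_(x in `[a, b]) Im (F x)).

Lemma eq_cint a b F G : (forall x, a <= x <= b -> F x = G x) ->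
  cint a b F = cint a b G.
Proof.
move=> h; by rewrite /cint; congr (_ +i* _); apply: eq_Rintegral => x;
  rewrite inE /= in_itv /= => /h ->.
Qed.

Lemma cintD a b F G : ccont a b F -> ccont a b G ->
  cint a b (fun x => F x + G x) = cint a b F + cint a b G.
Proof.
move=> hF hG; rewrite /cint.
rewrite [RHS]/GRing.add /=; congr (_ +i* _).
  rewrite -RintegralD //; [|exact: ccont_Re|exact: ccont_Re].
  by apply: eq_Rintegral => x _; case: (F x); case: (G x).
rewrite -RintegralD //; [|exact: ccont_Im|exact: ccont_Im].
by apply: eq_Rintegral => x _; case: (F x); case: (G x).
Qed.

Lemma fine_mu_itv a b : a <= b -> fine (mu `[a, b]) = b - a.
Proof.
move=> ab; rewrite lebesgue_measure_itv /= lte_fin.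
by case: ltgtP ab => // ->; rewrite subrr.
Qed.

(** Real and imaginary parts are bounded separately, whence the factor 2. *)
Lemma cint_norm a b F M : a <= b -> ccont a b F ->
  (forall x, a <= x <= b -> rn (F x) <= M) -> rn (cint a b F) <= 2 * M * (b - a).
Proof.
move=> ab hF hM.
have mab := fine_mu_itv ab.
have icst : mu.-integrable `[a, b] (EFin \o cst M).
  by apply: for_continuous_integrable => x _; exact: cvg_cst.
have step (p : R[i] -> R) : (forall z, `|p z| <= rn z) ->
    mu.-integrable `[a, b] (EFin \o (p \o F)) ->
    `|\int[mu]_(x in `[a, b]) p (F x)| <= M * (b - a).
  move=> hp ip; apply: le_trans (le_normr_Rintegral _ ip) _ => //.
  rewrite -mab -Rintegral_cst //; apply: le_Rintegral => //.
    by have := integrable_norm ip.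
  move=> x /=; rewrite in_itv /= => /hM; exact: le_trans.
apply: le_trans (rn_le_ReIm _) _ => /=.
rewrite -mulrA mulr_natl mulr2n lerD //; apply: step.
- exact: Re_le_rn.
- exact: ccont_Re.
- exact: Im_le_rn.
- exact: ccont_Im.
Qed.

Lemma cint_split a m b F : a <= m <= b -> ccont a b F ->
  cint a b F = cint a m F + cint m b F.
Proof.
move=> /andP[am mb] hF.
have step (f : R -> R) : mu.-integrable `[a, b] (EFin \o f) ->
    \int[mu]_(x in `[a, b]) f x =
    \int[mu]_(x in `[a, m]) f x + \int[mu]_(x in `[m, b]) f x.
  move=> i; apply/eqP; rewrite addrC -subr_eq; apply/eqP.
  rewrite Rintegral_itvB //.
  apply: Rintegral_itv_obnd_cbnd; apply: integrableS i => //.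
  by apply: subset_itv => //=; rewrite ?bnd_simp.
rewrite /cint [RHS]/GRing.add /=; congr (_ +i* _); apply: step.
- exact: ccont_Re.
- exact: ccont_Im.
Qed.

Lemma cint_cst a b (k : R[i]) : a <= b -> cint a b (cst k) = k * (b - a)%:C.
Proof.
move=> ab.
have mab := fine_mu_itv ab.
rewrite /cint !Rintegral_cst // mab; case: k => u v /=.
by apply/eqP; rewrite eq_complex /= !mulr0 subr0 add0r !eqxx.
Qed.

Lemma ccontD a b F G : ccont a b F -> ccont a b G ->
  ccont a b (fun x => F x + G x).
Proof. by move=> hF hG x xab; apply: cvgD; [apply: hF|apply: hG]. Qed.

Lemma ccontN a b F : ccont a b F -> ccont a b (fun x => - F x).
Proof. by move=> hF x xab; apply: cvgN; apply: hF. Qed.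

Lemma ccontB a b F G : ccont a b F -> ccont a b G ->
  ccont a b (fun x => F x - G x).
Proof. by move=> hF hG; apply: (ccontD hF); apply: ccontN. Qed.

Lemma ccont_sub a b a' b' F : a <= a' -> b' <= b -> ccont a b F -> ccont a' b' F.
Proof.
move=> aa bb h x /andP[ax xb]; apply: h; rewrite (le_trans aa ax) /=.
exact: le_trans xb bb.
Qed.

Lemma cint_Im_ge a b F (m : R) : a <= b -> ccont a b F ->
  (forall x, a <= x <= b -> m <= Im (F x)) -> m * (b - a) <= Im (cint a b F).
Proof.
move=> ab hF hM.
have mab := fine_mu_itv ab.
rewrite /= -mab -Rintegral_cst //; apply: le_Rintegral => //.
- by apply: for_continuous_integrable => x _; exact: cvg_cst.
- exact: ccont_Im.
Qed.

Lemma cintZ a b F (k : R[i]) : ccont a b F ->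
  cint a b (fun x => k * F x) = k * cint a b F.
Proof.
move=> hF; have hR := ccont_Re hF; have hI := ccont_Im hF.
case: k => u v.
have e1 : forall x, Re ((u +i* v) * F x) = u * Re (F x) - v * Im (F x).
  by move=> x; case: (F x).
have e2 : forall x, Im ((u +i* v) * F x) = u * Im (F x) + v * Re (F x).
  by move=> x; case: (F x).
have mi w (f : R -> R) : (forall x, a <= x <= b -> {for x, continuous f}) ->
    mu.-integrable `[a, b] (EFin \o (fun x => w * f x)).
  move=> cf; apply: for_continuous_integrable => x xab.
  by apply: cvgM; [exact: cvg_cst|exact: cf].
have cR x : a <= x <= b -> {for x, continuous (Re \o F)}.
  by move=> /hF; exact: for_continuous_Re.
have cI x : a <= x <= b -> {for x, continuous (Im \o F)}.
  by move=> /hF; exact: for_continuous_Im.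
rewrite /cint [RHS]/GRing.mul /=; congr (_ +i* _).
  rewrite -!RintegralZl // -RintegralB //; try by [exact: (mi _ _ cR)|exact: (mi _ _
    cI)].
  by apply: eq_Rintegral => x _; rewrite e1.
rewrite -!RintegralZl // -RintegralD //; try by [exact: (mi _ _ cR)|exact: (mi _ _ cI)].
by apply: eq_Rintegral => x _; rewrite e2.
Qed.

End ComplexIntegral.

(** * Goursat's theorem for rectangles *)

Section Goursat.
Context {R : realType}.
Implicit Types (F : R[i] -> R[i]) (a b c d x y : R).

Definition cderiv F (z k : R[i]) := forall e : R, 0 < e ->
  exists2 r : R, 0 < r &
    forall w, rn (w - z) < r -> rn (F w - F z - k * (w - z)) <= e * rn (w - z).

Lemma cderiv_continuous F z k : cderiv F z k -> {for z, continuous F}.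
Proof.
move=> h; apply/continuous_rnP => e e0; have [r r0 hr] := h _ ltr01.
exists (Num.min r (e / (2 + rn k))).
  by rewrite lt_min r0 divr_gt0 // ltr_pwDl // rn_ge0.
have k0 := rn_ge0 k.
move=> w; rewrite lt_min ltr_pdivlMr; last lra.
move=> /andP[/hr wr we].
have := rnD (F w - F z - k * (w - z)) (k * (w - z)).
rewrite subrK rnM => /le_lt_trans; apply.
have := rn_ge0 (w - z); nra.
Qed.

Definition rcont a b c d F :=
  forall x y, a <= x <= b -> c <= y <= d -> {for x +i* y, continuous F}.

Lemma rcont_sub a b c d a' b' c' d' F : a <= a' -> b' <= b -> c <= c' -> d' <= d ->
  rcont a b c d F -> rcont a' b' c' d' F.
Proof.
move=> aa bb cc dd h x y /andP[ax xb] /andP[cy yd]; apply: h.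
  by rewrite (le_trans aa ax) (le_trans xb bb).
by rewrite (le_trans cc cy) (le_trans yd dd).
Qed.

Lemma ccont_x a b F y : (forall x, a <= x <= b -> {for x +i* y, continuous F}) ->
  ccont a b (fun x => F (x +i* y)).
Proof.
move=> h x xb; apply/cvg_rnP => e e0.
have /continuous_rnP/(_ _ e0)[r r0 hr] := h x xb.
near=> t; apply: hr.
have -> : (t +i* y) - (x +i* y) = (t - x)%:C.
  by apply/eqP; rewrite eq_complex /= subrr !eqxx.
rewrite rn_real; near: t.
by apply/nbhs_normP; exists r => //= t /=; rewrite distrC.
Unshelve. all: by end_near. Qed.

Lemma ccont_y c d F x : (forall y, c <= y <= d -> {for x +i* y, continuous F}) ->
  ccont c d (fun y => F (x +i* y)).
Proof.
move=> h y yd; apply/cvg_rnP => e e0.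
have /continuous_rnP/(_ _ e0)[r r0 hr] := h y yd.
near=> t; apply: hr.
have -> : (x +i* t) - (x +i* y) = 'i * (t - y)%:C.
  by apply/eqP; rewrite eq_complex /= subrr !mul0r mulr0 !mul1r subr0 add0r !eqxx.
rewrite rnM rn_i mul1r rn_real; near: t.
by apply/nbhs_normP; exists r => //= t /=; rewrite distrC.
Unshelve. all: by end_near. Qed.

Lemma rcont_x a b c d F y : c <= y <= d -> rcont a b c d F ->
  ccont a b (fun x => F (x +i* y)).
Proof. by move=> yd h; apply: ccont_x => x xb; exact: h. Qed.

Lemma rcont_y a b c d F x : a <= x <= b -> rcont a b c d F ->
  ccont c d (fun y => F (x +i* y)).
Proof. by move=> xb h; apply: ccont_y => y yd; exact: h. Qed.

(* The integral of F over the boundary of [a, b] x [c, d], opposite sides being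
   paired so that affine functions have constant integrands. *)
Definition rect a b c d F : R[i] :=
  cint a b (fun x => F (x +i* c) - F (x +i* d)) +
  'i * cint c d (fun y => F (b +i* y) - F (a +i* y)).

Lemma rect_splitx a m b c d F : a <= m <= b ->
  ccont a b (fun x => F (x +i* c)) -> ccont a b (fun x => F (x +i* d)) ->
  ccont c d (fun y => F (a +i* y)) -> ccont c d (fun y => F (m +i* y)) ->
  ccont c d (fun y => F (b +i* y)) ->
  rect a b c d F = rect a m c d F + rect m b c d F.
Proof.
move=> amb hc hd ha hm hb; rewrite /rect (cint_split amb (ccontB hc hd)).
have -> : cint c d (fun y => F (b +i* y) - F (a +i* y)) =
   cint c d (fun y => F (m +i* y) - F (a +i* y)) +
   cint c d (fun y => F (b +i* y) - F (m +i* y)).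
  rewrite -(cintD (ccontB hm ha) (ccontB hb hm)).
  by apply: eq_cint => y _; rewrite [RHS]addrC addrA subrK.
by rewrite mulrDr addrACA.
Qed.

Lemma rect_splity a b c m d F : c <= m <= d ->
  ccont c d (fun y => F (a +i* y)) -> ccont c d (fun y => F (b +i* y)) ->
  ccont a b (fun x => F (x +i* c)) -> ccont a b (fun x => F (x +i* m)) ->
  ccont a b (fun x => F (x +i* d)) ->
  rect a b c d F = rect a b c m F + rect a b m d F.
Proof.
move=> cmd ha hb hc hm hd; rewrite /rect (cint_split cmd (ccontB hb ha)).
have -> : cint a b (fun x => F (x +i* c) - F (x +i* d)) =
   cint a b (fun x => F (x +i* c) - F (x +i* m)) +
   cint a b (fun x => F (x +i* m) - F (x +i* d)).
  rewrite -(cintD (ccontB hc hm) (ccontB hm hd)).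
  by apply: eq_cint => y _; rewrite [RHS]addrA subrK.
by rewrite mulrDr addrACA.
Qed.

(** Continuity on the sides only: the Cauchy estimate integrates functions that are singular at the
    centre of the square. *)
Definition fcont a b c d F :=
  [/\ ccont a b (fun x => F (x +i* c)), ccont a b (fun x => F (x +i* d)),
      ccont c d (fun y => F (a +i* y)) & ccont c d (fun y => F (b +i* y))].

Lemma rcont_fcont a b c d F : a <= b -> c <= d -> rcont a b c d F -> fcont a b c d F.
Proof.
move=> ab cd hF; split; [apply: rcont_x hF|apply: rcont_x hF|apply: rcont_y hF|apply:
  rcont_y hF];
  by rewrite ?lexx ?ab ?cd.
Qed.

Lemma rect_norm a b c d F (M : R) : a <= b -> c <= d -> fcont a b c d F ->
  (forall x, a <= x <= b -> rn (F (x +i* c)) <= M /\ rn (F (x +i* d)) <= M) ->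
  (forall y, c <= y <= d -> rn (F (a +i* y)) <= M /\ rn (F (b +i* y)) <= M) ->
  rn (rect a b c d F) <= 4 * M * ((b - a) + (d - c)).
Proof.
move=> ab cd [h1 h2 h3 h4] hx hy.
have bound z w : rn (F z) <= M -> rn (F w) <= M -> rn (F z - F w) <= 2 * M.
  by move=> M1 M2; have := rnD (F z) (- F w); rewrite rnN; lra.
apply: le_trans (rnD _ _) _; rewrite rnM rn_i mul1r.
have -> : 4 * M * ((b - a) + (d - c)) =
  2 * (2 * M) * (b - a) + 2 * (2 * M) * (d - c) by ring.
apply: lerD.
  by apply: (cint_norm ab (ccontB h1 h2)) => x /hx[]; exact: bound.
by apply: (cint_norm cd (ccontB h4 h3)) => x /hy[] *; apply: bound.
Qed.

Lemma rectD a b c d F G : fcont a b c d F -> fcont a b c d G ->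
  rect a b c d (fun z => F z + G z) = rect a b c d F + rect a b c d G.
Proof.
move=> [h1 h2 h3 h4] [k1 k2 k3 k4].
rewrite /rect addrACA -mulrDr -(cintD (ccontB h1 h2) (ccontB k1 k2)).
rewrite -(cintD (ccontB h4 h3) (ccontB k4 k3)).
by congr (_ + _ * _); apply: eq_cint => t _; rewrite opprD addrACA.
Qed.

Lemma rectZ a b c d F k : fcont a b c d F ->
  rect a b c d (fun z => k * F z) = k * rect a b c d F.
Proof.
move=> [h1 h2 h3 h4].
rewrite /rect mulrDr mulrCA -(cintZ _ (ccontB h1 h2)) -(cintZ _ (ccontB h4 h3)).
by congr (_ + _ * _); apply: eq_cint => t _; rewrite mulrBr.
Qed.

Lemma rect_affine a b c d (p k : R[i]) : a <= b -> c <= d ->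
  rect a b c d (fun z => p + k * z) = 0.
Proof.
move=> ab cd; rewrite /rect.
rewrite (@eq_cint _ _ _ _ (cst (k * ('i * (c - d)%:C)))); last first.
  move=> x _ /=; rewrite opprD addrACA subrr add0r -mulrBr; congr (_ * _).
  by apply/eqP; rewrite eq_complex /= subrr !mul0r mulr0 !mul1r subr0 add0r !eqxx.
rewrite (@eq_cint _ c d _ (cst (k * (b - a)%:C))); last first.
  move=> x _ /=; rewrite opprD addrACA subrr add0r -mulrBr; congr (_ * _).
  by apply/eqP; rewrite eq_complex /= subrr !eqxx.
rewrite !cint_cst // -(opprB d c) rmorphN; ring.
Qed.

Lemma rcont_affine a b c d (p k : R[i]) : rcont a b c d (fun z => p + k * z).
Proof.
move=> x y _ _; apply: (@cderiv_continuous _ _ k) => e e0; exists 1 => // w _.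
have -> : p + k * w - (p + k * (x +i* y)) - k * (w - (x +i* y)) = 0 by ring.
by rewrite rn0 mulr_ge0 ?rn_ge0 // ltW.
Qed.

Lemma nested_intervals (u v : nat -> R) :
  (forall k, u k <= u k.+1) -> (forall k, v k.+1 <= v k) -> (forall k, u k <= v k) ->
  exists p, forall k, u k <= p <= v k.
Proof.
move=> hu hv uv.
have mu : {homo u : i j / (i <= j)%N >-> i <= j}.
  by apply: homo_leq hu => //; exact: le_trans.
have mv : {homo v : i j / (i <= j)%N >-> j <= i}.
  by apply: homo_leq hv => // x y z h1 h2; exact: le_trans h2 h1.
have ub k : ubound (range u) (v k).
  move=> _ [j _ <-]; case: (leqP j k) => jk.
    exact: le_trans (mu _ _ jk) (uv k).
  by apply: le_trans (uv j) (mv _ _ _); exact: ltnW.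
have hs : has_sup (range u) by split; [exists (u 0%N), 0%N|exists (v 0%N)].
exists (sup (range u)) => k; apply/andP; split.
  by apply: sup_upper_bound => //; exists k.
by apply: ge_sup => //; exists (u 0%N), 0%N.
Qed.

(** Integrals over shared sides cancel, so the four quarters add up to the whole and one of them
    carries a quarter of the modulus. *)
Lemma rect_bisect a b c d F (T : R) : a <= b -> c <= d -> rcont a b c d F ->
  T <= rn (rect a b c d F) ->
  exists a' b' c' d', [/\ a <= a', b' <= b, c <= c', d' <= d &
    [/\ b' - a' = (b - a) / 2, d' - c' = (d - c) / 2 &
        T / 4 <= rn (rect a' b' c' d' F)]].
Proof.
move=> ab cd hF hT.
pose m := (a + b) / 2; pose n := (c + d) / 2.
have am : a <= m by rewrite /m; lra.
have mb : m <= b by rewrite /m; lra.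
have cn : c <= n by rewrite /n; lra.
have nd : n <= d by rewrite /n; lra.
have h4 : rect a b c d F = (rect a m c n F + rect a m n d F) +
                           (rect m b c n F + rect m b n d F).
  have hx y : c <= y <= d -> ccont a b (fun x => F (x +i* y)).
    by move=> yd; exact: rcont_x hF.
  have hy x : a <= x <= b -> ccont c d (fun y => F (x +i* y)).
    by move=> yd; exact: rcont_y hF.
  have [hc hn hd] : [/\ c <= c <= d, c <= n <= d & c <= d <= d].
    by rewrite !lexx cn nd cd.
  have [ha hm hb] : [/\ a <= a <= b, a <= m <= b & a <= b <= b].
    by rewrite !lexx am mb ab.
  have sx y : c <= y <= d -> ccont a m (fun x => F (x +i* y)) /\
      ccont m b (fun x => F (x +i* y)).
    by move=> /hx h; split; apply: ccont_sub h.
  rewrite (rect_splitx hm (hx _ hc) (hx _ hd) (hy _ ha) (hy _ hm) (hy _ hb)).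
  have [[c1 c2] [n1 n2] [d1 d2]] := And3 (sx _ hc) (sx _ hn) (sx _ hd).
  rewrite (rect_splity hn (hy _ ha) (hy _ hm) c1 n1 d1).
  by rewrite (rect_splity hn (hy _ hm) (hy _ hb) c2 n2 d2).
have pigeon (r s t r1 r2 r3 r4 : R) : T <= r -> r <= s + t -> s <= r1 + r2 ->
    t <= r3 + r4 -> [|| T / 4 <= r1, T / 4 <= r2, T / 4 <= r3 | T / 4 <= r4].
  move=> *; case: leP => // ?; case: leP => // ?; case: leP => // ? /=; lra.
move: hT; rewrite h4 => /pigeon/(_ (rnD _ _) (rnD _ _) (rnD _ _)) /or4P[] h.
- by exists a, m, c, n; split=> //; split=> //; rewrite /m /n; field.
- by exists a, m, n, d; split=> //; split=> //; rewrite /m /n; field.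
- by exists m, b, c, n; split=> //; split=> //; rewrite /m /n; field.
- by exists m, b, n, d; split=> //; split=> //; rewrite /m /n; field.
Qed.

Lemma rn_complex_le x y : rn (x +i* y) <= `|x| + `|y|.
Proof. exact: rn_le_ReIm. Qed.

(** Subtracting an affine function leaves the integral unchanged, so only the deviation from it
    counts. *)
Lemma rect_approx a b c d F (e : R) (p k : R[i]) : a <= b -> c <= d ->
  rcont a b c d F ->
  (forall x y, a <= x <= b -> c <= y <= d -> rn (F (x +i* y) - (p + k * (x +i* y))) <=
    e) ->
  rn (rect a b c d F) <= 4 * e * ((b - a) + (d - c)).
Proof.
move=> ab cd hF he.
pose G z := F z + (- p + (- k) * z).
have hA := @rcont_affine a b c d (- p) (- k).
have hG : rcont a b c d G.
  by move=> x y xb yd; apply: continuousD; [exact: hF|exact: hA].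
have -> : rect a b c d F = rect a b c d G.
  by rewrite /G (rectD (rcont_fcont ab cd hF) (rcont_fcont ab cd hA)) rect_affine //
    addr0.
have eG x y : a <= x <= b -> c <= y <= d -> rn (G (x +i* y)) <= e.
  move=> xb yd; rewrite /G (_ : - p + - k * _ = - (p + k * (x +i* y))).
    exact: he.
  by rewrite opprD mulNr.
by apply: (rect_norm ab cd (rcont_fcont ab cd hG)) => t ht; split; apply: eG => //;
  rewrite ?lexx ?ab ?cd.
Qed.

Lemma dist_segment (u v x p : R) : u <= x <= v -> u <= p <= v -> `|x - p| <= v - u.
Proof. by rewrite ler_norml; lra. Qed.

(** Repeated bisection keeps an integral of at least T / 4^k. Around the limit point F is affine up
    to e times the distance, and both the diameter and the perimeter scale like 2^-k, which bounds
    the same integral by 4 e W^2 / 4^k. *)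
Lemma goursat a b c d F : a <= b -> c <= d ->
  (forall x y, a <= x <= b -> c <= y <= d -> exists k, cderiv F (x +i* y) k) ->
  rect a b c d F = 0.
Proof.
move=> ab cd dF.
have cF : rcont a b c d F.
  by move=> x y xb yd; have [k hk] := dF x y xb yd; exact: cderiv_continuous hk.
apply: rn_eq0; apply/eqP; rewrite eq_le rn_ge0 andbT.
apply/negP => /negP; rewrite -ltNge; set T := rn _ => T0.
pose W := (b - a) + (d - c).
(* The rectangle [a, b] x [c, d] is encoded as q = ((a, b), (c, d)). *)
pose bad k (q : (R * R) * (R * R)) :=
  [/\ a <= q.1.1, q.1.2 <= b, c <= q.2.1, q.2.2 <= d &
   [/\ q.1.2 - q.1.1 = (b - a) / 2 ^+ k, q.2.2 - q.2.1 = (d - c) / 2 ^+ k &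
    T / 4 ^+ k <= rn (rect q.1.1 q.1.2 q.2.1 q.2.2 F)]].
have bad_ord k q : bad k q -> q.1.1 <= q.1.2 /\ q.2.1 <= q.2.2.
  move=> [_ _ _ _ [h1 h2 _]]; rewrite -(subr_ge0 q.1.1) -(subr_ge0 q.2.1) h1 h2
    !divr_ge0 ?exprn_ge0 ?subr_ge0 //.
(* [bad] is a premise inside the conclusion so that [choice] yields a total function; a rectangle
   that is not bad is returned unchanged. *)
have step (kq : nat * ((R * R) * (R * R))) : exists q',
  bad kq.1 kq.2 -> bad kq.1.+1 q' /\
    [/\ kq.2.1.1 <= q'.1.1, q'.1.2 <= kq.2.1.2,
      kq.2.2.1 <= q'.2.1 & q'.2.2 <= kq.2.2.2].
  case: kq => k q /=.
  have [hb|] := pselect (bad k q); last by exists q.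
  have [le1 le2] := bad_ord _ _ hb.
  case: hb => [q1 q2 q3 q4 [q5 q6 q7]].
  have := rect_bisect le1 le2 (rcont_sub q1 q2 q3 q4 cF) q7.
  move=> [a' [b' [c' [d' [h1 h2 h3 h4 [h5 h6 h7]]]]]].
  exists ((a', b'), (c', d')) => _; split; last by split.
  split => /=; [exact: le_trans h1|exact: le_trans q2|exact: le_trans h3|exact:
    le_trans q4|].
  split.
  - by rewrite h5 q5 exprSr invfM mulrA.
  - by rewrite h6 q6 exprSr invfM mulrA.
  - by rewrite exprSr invfM mulrA.
have [g hg] := choice step.
pose q := fix q k := if k is k'.+1 then g (k', q k') else ((a, b), (c, d)).
have hq k : bad k (q k).
  elim: k => [|k IH]; last by have [] := hg (k, q k) IH.
  by split=> //=; split; rewrite ?expr0 ?divr1.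
have mq k : [/\ (q k).1.1 <= (q k.+1).1.1, (q k.+1).1.2 <= (q k).1.2,
    (q k).2.1 <= (q k.+1).2.1 & (q k.+1).2.2 <= (q k).2.2].
  by have [] := hg (k, q k) (hq k).
have [px hpx] : exists p, forall k, (q k).1.1 <= p <= (q k).1.2.
  apply: nested_intervals => k; [by case: (mq k)|by case: (mq k)|].
  by case: (bad_ord _ _ (hq k)).
have [py hpy] : exists p, forall k, (q k).2.1 <= p <= (q k).2.2.
  apply: nested_intervals => k; [by case: (mq k)|by case: (mq k)|].
  by case: (bad_ord _ _ (hq k)).
have [K hK] := dF _ _ (hpx 0%N) (hpy 0%N).
have W0 : 0 <= W by rewrite /W addr_ge0 ?subr_ge0.
have W1 : 0 < W + 1 by lra.
(* Then T = 8 e (W + 1)^2 exceeds 4 e W^2; the added 1 covers degenerate rectangles with W = 0. *)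
pose e := T / (8 * (W + 1) ^+ 2).
have e0 : 0 < e by rewrite /e divr_gt0 // mulr_gt0 // exprn_gt0.
have [r r0 hr] := hK e e0.
have [k hk] : exists k, W / 2 ^+ k < r.
  have [k hk] : exists k, W / r < 2 ^+ k.
    exists (Num.truncn (W / r)).+1.
    apply: lt_trans (truncnS_gt _) _; rewrite -natrX ltr_nat; exact: ltn_expl.
  by exists k; rewrite ltr_pdivrMr ?exprn_gt0 // mulrC -ltr_pdivrMr.
have [hx hy] := (hpx k, hpy k).
have [le1 le2] := bad_ord _ _ (hq k).
case: (hq k) => [q1 q2 q3 q4 [q5 q6 q7]].
have bnd : forall x y, (q k).1.1 <= x <= (q k).1.2 -> (q k).2.1 <= y <= (q k).2.2 ->
   rn ((x +i* y) - (px +i* py)) <= W / 2 ^+ k.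
  move=> x y xb yb; apply: le_trans (rn_complex_le (x - px) (y - py)) _.
  by rewrite /W mulrDl -q5 -q6; apply: lerD; exact: dist_segment.
have := @rect_approx _ _ _ _ F (e * (W / 2 ^+ k)) (F (px +i* py) - K * (px +i* py)) K
  le1 le2
   (rcont_sub q1 q2 q3 q4 cF).
have -> : (q k).1.2 - (q k).1.1 + ((q k).2.2 - (q k).2.1) = W / 2 ^+ k.
  by rewrite q5 q6 -mulrDl.
move=> H.
have {H} : rn (rect (q k).1.1 (q k).1.2 (q k).2.1 (q k).2.2 F) <= 4 * (e * (W / 2 ^+
  k)) * (W / 2 ^+ k).
  apply: H => x y xb yb; have Hb := bnd x y xb yb.
  set z := (x +i* y) in Hb *; set p := (px +i* py) in Hb *.
  have -> : F z - (F p - K * p + K * z) = F z - F p - K * (z - p) by ring.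
  apply: le_trans (hr z (le_lt_trans Hb hk)) _.
  by rewrite ler_wpM2l // ltW.
move=> /(le_trans q7); apply/negP; rewrite -ltNge.
have -> : T / 4 ^+ k = (8 * e * (W + 1) ^+ 2) / 4 ^+ k.
  rewrite /e; congr (_ / _); field; lra.
have -> : 4 * (e * (W / 2 ^+ k)) * (W / 2 ^+ k) = (4 * e * W ^+ 2) / 4 ^+ k.
  have -> : (4 : R) = 2 * 2 by ring.
  rewrite exprMn; field; rewrite expf_neq0 //.
rewrite ltr_pM2r ?invr_gt0 ?exprn_gt0 //; nra.
Qed.

End Goursat.

(** * Complex differentiability expressed with the real-valued norm *)

Section Bridge.
Context {R : realType}.
Implicit Types V W : normedModType R[i].

(** Clearing the denominator of the difference quotient admits t = 0 and leaves a plain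
    inequality. *)
Lemma is_derive_rnP V W (h : V -> W) (a v : V) (k : W) :
  is_derive a v h k <-> forall e : R, 0 < e -> exists2 r : R, 0 < r &
    forall t : R[i], rn t < r -> rn (h (a + t *: v) - h a - t *: k) <= e * rn t.
Proof.
have E : is_derive a v h k <->
    (fun t => t^-1 *: ((h \o shift a) (t *: v) - h a)) @ 0^' --> k.
  split=> [[dh <-] //|hk]; split; first by apply/cvg_ex; exists k.
  by apply/cvg_lim.
rewrite E cvg_rnP; split=> H e e0.
  have := H e e0; rewrite near_withinE => /nbhs_rnP[r r0 hr].
  exists r => // t tr; have [->|t0] := eqVneq t 0.
    by rewrite !scale0r addr0 !subrr !rn0 mulr0.
  have := hr t; rewrite subr0 => /(_ tr t0) /ltW /=.
  rewrite -(ler_pM2r (rn_gt0 t0)) mulrC -rnZ scalerBr scalerA divff // scale1r.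
  by rewrite (addrC _ a).
have e20 : 0 < e / 2 by rewrite divr_gt0.
have [r r0 hr] := H _ e20.
rewrite near_withinE; apply/nbhs_rnP; exists r => // t; rewrite subr0 => tr t0 /=.
rewrite -(ltr_pM2r (rn_gt0 t0)) mulrC -rnZ scalerBr scalerA divff // scale1r.
rewrite (addrC _ a); apply: le_lt_trans (hr t tr) _.
rewrite ltr_pM2r ?rn_gt0 //; lra.
Qed.

Lemma cderivP (F : R[i] -> R[i]) (z k : R[i]) :
  is_derive z (1 : R[i]) F k <-> cderiv F z k.
Proof.
rewrite is_derive_rnP; split=> H e e0; have [r r0 hr] := H e e0; exists r => //.
  move=> w wr; have := hr (w - z) wr.
  by rewrite [_ *: (1 : R[i])]mulr1 (addrC z) subrK [_ *: k]mulrC.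
move=> t tr; have := hr (z + t); rewrite (addrC z t) addrK => /(_ tr).
by rewrite [_ *: (1 : R[i])]mulr1 (addrC z t) [_ *: k]mulrC.
Qed.

(** The way back from estimates to Frechet differentiability, used for uniform limits, where the
    candidate L is built by hand. *)
Lemma differentiable_of_rn V W (h : V -> W) (a : V) (L : {linear V -> W}) (C : R) :
  (forall v, rn (L v) <= C * rn v) ->
  (forall e : R, 0 < e -> exists2 r : R, 0 < r &
    forall v, rn v < r -> rn (h (a + v) - h a - L v) <= e * rn v) ->
  differentiable h a /\ 'd h a = L :> (V -> W).
Proof.
move=> hC hL.
have Lc : continuous L.
  move=> x; apply/continuous_rnP => e e0.
  have C1 : 0 < `|C| + 1 by rewrite ltr_wpDl.
  exists (e / (`|C| + 1)); first by rewrite divr_gt0.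
  move=> w; rewrite ltr_pdivlMr // => hw; rewrite -linearB.
  apply: le_lt_trans (hC _) _; apply: le_lt_trans hw; rewrite mulrC.
  by rewrite ler_wpM2l ?rn_ge0 //; have := ler_norm C; lra.
have E : h \o shift a = cst (h a) + L +o_ 0 id.
  apply/eqaddoP => e e0; have er : e = (complex.Re e)%:C by rewrite RRe_real //
    gtr0_real.
  have e0' : 0 < complex.Re e by rewrite -ltcR -er.
  have [r r0 hr] := hL _ e0'; apply/nbhs_rnP; exists r => // v; rewrite subr0 => vr /=.
  rewrite -[X in `|X| <= _]/(h (v + a) - (h a + L v)).
  by rewrite er !normE -rmorphM lecR /= opprD addrA (addrC v); exact: hr.
split; last exact: diff_unique.
apply/diffP => /=.
(* The differential is a chosen map, so exhibiting one continuous linear map that meets its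
   specification is enough. *)
apply: (@getPex _ (fun (df : {linear V -> W}) => continuous df /\
  forall y, h y = h (lim (nbhs a)) + df (y - lim (nbhs a))
                  +o_(y \near a) (y - lim (nbhs a)))).
exists L; split=> //; apply: eqaddoEx => z; rewrite lim_id //.
suff Eh : h = (fun y => h a + L (y - a)) +o_ a (fun y => y - a).
  exact: (congr1 (fun k => k z) Eh).
apply/eqaddoP => e e0; move/eqaddoP: E => /(_ e e0) /nbhs_rnP[r r0 hr].
apply/nbhs_rnP; exists r => // y yr; have := hr (y - a); rewrite subr0 => /(_ yr) /=.
rewrite -[X in `|X| <= _]/(h (y - a + a) - (h a + L (y - a))) subrK.
by [].
Qed.

End Bridge.

(** * The Cauchy estimate *)

Section CauchyEstimate.
Context {R : realType}.
Implicit Types (F G : R[i] -> R[i]) (s r x y : R).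

Lemma complex_neq0 x y : x != 0 \/ y != 0 -> (x +i* y : R[i]) != 0.
Proof. by rewrite eq_complex /= negb_and => -[->|->] //; rewrite orbT. Qed.

(** Four cuts remove the rectangles to the left, to the right, below and above the small square;
    each misses 0, so Goursat's theorem applies to it. *)
Lemma rect_annulus G s r : 0 < r -> r <= s ->
  (forall x y, - s <= x <= s -> - s <= y <= s -> x != 0 \/ y != 0 ->
     exists k, cderiv G (x +i* y) k) ->
  rect (- s) s (- s) s G = rect (- r) r (- r) r G.
Proof.
move=> r0 rs dG.
have s0 : 0 < s by exact: lt_le_trans rs.
have cG x y : - s <= x <= s -> - s <= y <= s -> x != 0 \/ y != 0 ->
    {for x +i* y, continuous G}.
  by move=> h1 h2 h3; have [k] := dG x y h1 h2 h3; exact: cderiv_continuous.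
have cx y (a b : R) : - s <= a -> b <= s -> - s <= y <= s -> y != 0 ->
    ccont a b (fun x => G (x +i* y)).
  move=> h1 h2 h3 h4; apply: ccont_x => x xs; apply: cG => //; [lra|by right].
have cy x (c d : R) : - s <= c -> d <= s -> - s <= x <= s -> x != 0 ->
    ccont c d (fun y => G (x +i* y)).
  move=> h1 h2 h3 h4; apply: ccont_y => y ys; apply: cG => //; [lra|by left].
have zero a b c d : - s <= a -> a <= b -> b <= s -> - s <= c -> c <= d -> d <= s ->
    (0 < a \/ b < 0) \/ (0 < c \/ d < 0) -> rect a b c d G = 0.
  move=> h1 h2 h3 h4 h5 h6 h; apply: goursat => // x y xab ycd; apply: dG; [lra|lra|].
  have [] : (0 < x \/ x < 0) \/ (0 < y \/ y < 0).
  - by case: h => -[?|?]; [left;left|left;right|right;left|right;right]; lra.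
  - by move=> [?|?]; left; lra.
  - by move=> [?|?]; right; lra.
have [s1 s2 r1 r2] : [/\ s != 0, - s != 0, r != 0 & - r != 0] by split; lra.
have hs1 : - s <= s <= s by lra.
have hs2 : - s <= - s <= s by lra.
have hr1 : - s <= r <= s by lra.
have hr2 : - s <= - r <= s by lra.
have hs3 : - s <= - s by [].
have hs4 : s <= s by [].
have hr3 : - s <= - r by lra.
have hr4 : - r <= r <= s by lra.
have hr5 : - s <= r by lra.
rewrite (rect_splitx hr2 (cx _ _ _ hs3 hs4 hs2 s2) (cx _ _ _ hs3 hs4 hs1 s1)
  (cy _ _ _ hs3 hs4 hs2 s2) (cy _ _ _ hs3 hs4 hr2 r2) (cy _ _ _ hs3 hs4 hs1 s1)).
have -> : rect (- s) (- r) (- s) s G = 0 by apply: zero; lra.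
rewrite add0r.
rewrite (rect_splitx hr4 (cx _ _ _ hr3 hs4 hs2 s2) (cx _ _ _ hr3 hs4 hs1 s1)
  (cy _ _ _ hs3 hs4 hr2 r2) (cy _ _ _ hs3 hs4 hr1 r1) (cy _ _ _ hs3 hs4 hs1 s1)).
have -> : rect r s (- s) s G = 0 by apply: zero; lra.
rewrite addr0.
rewrite (rect_splity hr2 (cy _ _ _ hs3 hs4 hr2 r2) (cy _ _ _ hs3 hs4 hr1 r1)
  (cx _ _ _ hr3 rs hs2 s2) (cx _ _ _ hr3 rs hr2 r2) (cx _ _ _ hr3 rs hs1 s1)).
have -> : rect (- r) r (- s) (- r) G = 0 by apply: zero; lra.
rewrite add0r.
rewrite (rect_splity hr4 (cy _ _ _ hr3 hs4 hr2 r2) (cy _ _ _ hr3 hs4 hr1 r1)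
  (cx _ _ _ hr3 rs hr2 r2) (cx _ _ _ hr3 rs hr1 r1) (cx _ _ _ hr3 rs hs1 s1)).
have -> : rect (- r) r r s G = 0 by apply: zero; lra.
by rewrite addr0.
Qed.

Lemma cderiv_inv (z : R[i]) : z != 0 -> exists k, cderiv (fun z : R[i] => z^-1) z k.
Proof.
move=> z0; have d : derivable (fun z : R[i] => z^-1) z (1 : R[i]).
  by apply: derivableV => //; exact: derivable_id.
by eexists; apply/cderivP; exact: derivableP d.
Qed.

(** A lower bound standing in for the value 2 pi i: on each pair of opposite sides the imaginary
    part of the integrand is 2 r / (x^2 + r^2) >= 1 / r, and the length 2 r yields 2 per pair. *)
Lemma rect_inv r : 0 < r -> 4 <= rn (rect (- r) r (- r) r (fun z : R[i] => z^-1)).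
Proof.
move=> r0; have rr : - r <= r by lra.
have c x y : x != 0 \/ y != 0 -> {for (x +i* y : R[i]), continuous (fun z : R[i] =>
  z^-1)}.
  move=> h; have [k] := cderiv_inv (complex_neq0 h).
  exact: cderiv_continuous.
have [r1 r2] : r != 0 /\ - r != 0 by lra.
have cx y : y != 0 -> ccont (- r) r (fun x => (x +i* y)^-1).
  by move=> h; apply: (@ccont_x _ _ _ (fun z : R[i] => z^-1)) => *; apply: c; right.
have cy x : x != 0 -> ccont (- r) r (fun y => (x +i* y)^-1).
  by move=> h; apply: (@ccont_y _ _ _ (fun z : R[i] => z^-1)) => *; apply: c; left.
have c1 := ccontB (cx _ r2) (cx _ r1).
have c2 := ccontB (cy _ r1) (cy _ r2).
apply: le_trans (Im_le_rn _); apply: le_trans (ler_norm _).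
rewrite /rect -(cintZ _ c2).
have c3 : ccont (- r) r (fun y => 'i * ((r +i* y)^-1 - (- r +i* y)^-1)).
  by move=> y /c2 h; apply: cvgM; [exact: cvg_cst|exact: h].
have ImD (z w : R[i]) : complex.Im (z + w) = complex.Im z + complex.Im w.
  by case: z; case: w.
have bnd x : - r <= x <= r -> r^-1 <= (r / (x ^+ 2 + r ^+ 2)) *+ 2.
  move=> xr; rewrite -mulr_natr mulrAC ler_pdivlMr; last nra.
  rewrite mulrC ler_pdivrMr //; nra.
have h1 : r^-1 * (r - - r) <= complex.Im (cint (- r) r
    (fun x => (x -i* r)^-1 - (x +i* r)^-1)).
  apply: (cint_Im_ge rr c1) => x /bnd; rewrite ImB /= sqrrN mulNr opprK mulr2n.
  by [].
have h2 : r^-1 * (r - - r) <= complex.Im (cint (- r) r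
    (fun y => 'i * ((r +i* y)^-1 - (- r +i* y)^-1))).
  apply: (cint_Im_ge rr c3) => x /bnd /=.
  rewrite sqrrN mulNr !opprK mul0r mul1r add0r (addrC (x ^+ 2)) mulr2n.
  by [].
rewrite ImD; apply: le_trans (lerD h1 h2).
have -> : r^-1 * (r - - r) = 2 by field.
lra.
Qed.

Lemma cderivB_cst F (z k w : R[i]) : cderiv F z k -> cderiv (fun z => F z - w) z k.
Proof.
move=> h e e0; have [r r0 hr] := h e e0; exists r => // t /hr.
by rewrite opprB addrA subrK.
Qed.

(* The integral of (F z - F 0) / z ^ 2 over the boundary of a square centered at
   0 does not depend on the square; on small squares it is close to the integral
   of k / z. *)
Lemma cauchy_estimate F r (M : R) k : 0 < r ->
  (forall t, rn t < r -> exists k, cderiv F t k) ->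
  (forall t, rn t < r -> rn (F t) <= M) -> cderiv F 0 k -> rn k <= 100 * M / r.
Proof.
move=> r0 dF hM dk.
have M0 : 0 <= M by have := hM 0; rewrite rn0 => /(_ r0); exact: le_trans (rn_ge0 _).
(* With |z| <= |x| + |y| <= 2 s, the closed square stays inside the disc of radius r. *)
pose s := r / 3; have s0 : 0 < s by rewrite /s; lra.
have inr x y : - s <= x <= s -> - s <= y <= s -> rn (x +i* y) < r.
  move=> xs ys; apply: le_lt_trans (rn_complex_le _ _) _.
  have : `|x| <= s by rewrite ler_norml.
  have : `|y| <= s by rewrite ler_norml.
  rewrite /s; lra.
pose G z := (F z - F 0) * (z^-1 ^+ 2).
have dG x y : - s <= x <= s -> - s <= y <= s -> x != 0 \/ y != 0 ->
     exists k, cderiv G (x +i* y) k.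
  move=> xs ys /complex_neq0 h.
  have [k1 hk1] := dF _ (inr _ _ xs ys).
  have /cderivP hk2 := cderivB_cst (F 0) hk1.
  have [k3 /cderivP hk3] := cderiv_inv h.
  have h2 := is_deriveM hk3 hk3; have h3 := is_deriveM hk2 h2.
  by eexists; apply/cderivP; exact: h3.
have frame q (H : R[i] -> R[i]) : 0 < q -> q <= s ->
    (forall x y, - s <= x <= s -> - s <= y <= s -> x != 0 \/ y != 0 ->
      {for x +i* y, continuous H}) -> fcont (- q) q (- q) q H.
  move=> q0 qs cH; have [q1 q2] : q != 0 /\ - q != 0 by lra.
  split; [apply: ccont_x|apply: ccont_x|apply: ccont_y|apply: ccont_y] => t tq;
    apply: cH; [lra|lra|by right|lra|lra|by right|lra|lra|by left|lra|lra|by left].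
have cG x y : - s <= x <= s -> - s <= y <= s -> x != 0 \/ y != 0 ->
    {for x +i* y, continuous G}.
  by move=> h1 h2 h3; have [k1] := dG x y h1 h2 h3; exact: cderiv_continuous.
have cinv x y : - s <= x <= s -> - s <= y <= s -> x != 0 \/ y != 0 ->
    {for x +i* y, continuous (fun z : R[i] => z^-1)}.
  by move=> _ _ /complex_neq0 /cderiv_inv [k1]; exact: cderiv_continuous.
have ckinv x y : - s <= x <= s -> - s <= y <= s -> x != 0 \/ y != 0 ->
    {for x +i* y, continuous (fun z : R[i] => k * z^-1)}.
  by move=> h1 h2 h3; apply: continuousM; [exact: cst_continuous|exact: cinv].
have cE' x y : - s <= x <= s -> - s <= y <= s -> x != 0 \/ y != 0 ->
    {for x +i* y, continuous (fun z => G z - k * z^-1)}.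
  by move=> h1 h2 h3; apply: continuousB; [exact: cG|exact: ckinv].
have side q x : 0 < q -> - q <= x <= q -> [/\ q <= rn (x +i* q), q <= rn (x -i* q),
    q <= rn (q +i* x) & q <= rn (- q +i* x)].
  move=> q0 _; have q1 : q <= `|q| by exact: ler_norm.
  split; apply: le_trans q1 _.
  - exact: (Im_le_rn (x +i* q)).
  - by rewrite -normrN; exact: (Im_le_rn (x -i* q)).
  - exact: (Re_le_rn (q +i* x)).
  - by rewrite -normrN; exact: (Re_le_rn (- q +i* x)).
have bnd q (H : R[i] -> R[i]) (B : R) : 0 < q -> q <= s -> fcont (- q) q (- q) q H ->
    (forall z, q <= rn z -> rn z <= 2 * q -> rn (H z) <= B) ->
    rn (rect (- q) q (- q) q H) <= 16 * B * q.
  move=> q0 qs cH hH.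
  have le2 x y : - q <= x <= q -> - q <= y <= q -> rn (x +i* y) <= 2 * q.
    move=> xs ys; apply: le_trans (rn_complex_le _ _) _.
    have : `|x| <= q by rewrite ler_norml.
    have : `|y| <= q by rewrite ler_norml.
    lra.
  have -> : 16 * B * q = 4 * B * ((q - - q) + (q - - q)) by ring.
  have hq1 : - q <= q <= q by lra.
  have hq2 : - q <= - q <= q by lra.
  apply: rect_norm => //; [lra|lra| |].
    by move=> x xq; have [e1 e2 e3 e4] := side q x q0 xq; split; apply: hH => //;
      exact: le2.
  by move=> x xq; have [e1 e2 e3 e4] := side q x q0 xq; split; apply: hH => //;
    exact: le2.
have Gs : rn (rect (- s) s (- s) s G) <= 16 * (2 * M / s ^+ 2) * s.
  apply: bnd => // [|z z1 z2]; first exact: frame.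
  have z0 : 0 < rn z by exact: lt_le_trans z1.
  rewrite /G rnM rnX rnV; apply: ler_pM; rewrite ?rn_ge0 ?exprn_ge0 ?invr_ge0 ?rn_ge0
    //.
    have h1 := hM z; have h2 := hM 0; have := rnD (F z) (- F 0); rewrite rnN => h3.
    have : rn (F z) <= M by apply: h1; rewrite /s in z2; lra.
    have : rn (F 0) <= M by apply: h2; rewrite rn0.
    lra.
  rewrite -exprVn; apply: lerXn2r; rewrite ?nnegrE ?invr_ge0 ?(ltW z0) ?(ltW s0) //.
  by rewrite lef_pV2.
apply/ler_addgt0Pr => e e0.
(* On the square of half-side q the error term E is at most (e / 4) / q, so its integral is at most
   16 (e / 4) = 4 e. *)
have e4 : 0 < e / 4 by lra.
have [d d0 hd] := dk _ e4.
pose q := Num.min s (d / 3).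
have q0 : 0 < q by rewrite lt_min s0; lra.
have qs : q <= s by rewrite ge_min lexx.
have qd : 2 * q < d.
  have : q <= d / 3 by rewrite ge_min lexx orbT.
  lra.
pose E z := G z - k * z^-1.
have cE : fcont (- q) q (- q) q E /\ fcont (- q) q (- q) q (fun z => k * z^-1) /\
    fcont (- q) q (- q) q (fun z : R[i] => z^-1).
  by split; [|split]; apply: frame.
have hE : rn (rect (- q) q (- q) q E) <= 16 * (e / 4 / q) * q.
  apply: bnd => // [|z z1 z2]; first by case: cE.
  have z0 : 0 < rn z by exact: lt_le_trans z1.
  have zn : z != 0 by apply: contraTneq z0 => ->; rewrite rn0 ltxx.
  have -> : E z = (F z - F 0 - k * (z - 0)) * z^-1 ^+ 2 by rewrite /E /G; field.
  rewrite rnM rnX rnV.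
  have := hd z; rewrite subr0 => /(_ (le_lt_trans z2 qd)) h.
  apply: le_trans (_ : e / 4 * rn z * (rn z)^-1 ^+ 2 <= _).
    by rewrite ler_wpM2r // exprn_ge0 // invr_ge0 ltW.
  have -> : e / 4 * rn z * (rn z)^-1 ^+ 2 = e / 4 / rn z by field; lra.
  by apply: ler_wpM2l; [exact: ltW|rewrite lef_pV2].
have GE : rect (- q) q (- q) q G = rect (- q) q (- q) q E + k * rect (- q) q (- q) q
  (fun z : R[i] => z^-1).
  case: cE => c1 [c2 c3]; rewrite -(rectZ _ c3) -(rectD c1 c2).
  by congr rect; apply/funext => z; rewrite /E subrK.
have ann := rect_annulus q0 qs dG.
have := rect_inv q0; set J := rect _ _ _ _ (fun z : R[i] => z^-1) in GE *; move=> J4.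
have kJ : k * J = rect (- s) s (- s) s G - rect (- q) q (- q) q E.
  by rewrite ann GE [_ + k * J]addrC addrK.
have := rnD (rect (- s) s (- s) s G) (- rect (- q) q (- q) q E).
rewrite -kJ rnN rnM => h.
have k0 := rn_ge0 k.
(* Hence 4 |k| <= 96 M / r + 4 e, that is |k| <= 24 M / r + e; the constant 100 leaves room. *)
have h5 : rn k * 4 <= rn k * rn J by rewrite ler_wpM2l.
have s1 : 16 * (2 * M / s ^+ 2) * s = 96 * M / r by rewrite /s; field; lra.
have s2 : 16 * (e / 4 / q) * q = 4 * e by field; lra.
have s3 : 96 * M / r = 96 * (M / r) by rewrite mulrA.
have s4 : 100 * M / r = 100 * (M / r) by rewrite mulrA.
have s5 : 0 <= M / r by rewrite divr_ge0 // ltW.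
rewrite s1 s3 in Gs; rewrite s2 in hE; rewrite s4.
lra.
Qed.
End CauchyEstimate.

(** * Restriction to complex lines and the mean value inequality *)

Section Holomorphic.
Context {R : realType}.
Implicit Types (V W : normedModType R[i]).
Local Notation C := (R[i]).

Lemma cderiv_line V (h : V -> C) (a v : V) (t k : C) :
  is_derive (a + t *: v) v h k <-> cderiv (fun t => h (a + t *: v)) t k.
Proof.
rewrite is_derive_rnP; split=> H e e0; have [r r0 hr] := H e e0; exists r => //.
  move=> w wr; have := hr (w - t) wr.
  by rewrite -(addrA a) -scalerDl (addrC t) subrK [_ *: k]mulrC.
move=> w wr; have := hr (t + w); rewrite (addrC t w) addrK => /(_ wr).
by rewrite -(addrA a) -scalerDl (addrC t w) [_ *: k]mulrC.
Qed.

Lemma differentiable_derive V (h : V -> C) (a v : V) : differentiable h a ->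
  is_derive a v h ('D_v h a).
Proof. by move=> dh; apply: derivableP; exact: diff_derivable. Qed.

Lemma differentiable_line V (h : V -> C) (a v : V) (t : C) :
  differentiable h (a + t *: v) ->
  cderiv (fun t => h (a + t *: v)) t ('D_v h (a + t *: v)).
Proof. by move=> /(differentiable_derive v) /cderiv_line. Qed.

(** The one-variable estimate on the line a + t v, with t in the disc of radius r / |v|. *)
Lemma derive_bound V (h : V -> C) (a v : V) (r M : R) : 0 < r ->
  (forall x, rnball a r x -> differentiable h x) ->
  (forall x, rnball a r x -> rn (h x) <= M) ->
  rn ('D_v h a) <= 100 * M * rn v / r.
Proof.
move=> r0 dh hM; have [->|v0] := eqVneq v 0.
  by rewrite derive0 !rn0 mulr0 mul0r.
have nv := rn_gt0 v0.
have inB (t : C) : rn t < r / rn v -> rnball a r (a + t *: v).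
  by rewrite /rnball /= (addrC a) addrK rnZ ltr_pdivlMr.
have := @cauchy_estimate _ (fun t => h (a + t *: v)) (r / rn v) M ('D_v h a).
have -> : 100 * M / (r / rn v) = 100 * M * rn v / r by field; lra.
apply.
- by rewrite divr_gt0.
- move=> t /inB /dh dt; exists ('D_v h (a + t *: v)); exact: differentiable_line.
- by move=> t /inB /hM.
have := @differentiable_line V h a v 0; rewrite scale0r addr0; apply.
by apply: dh; exact: rnball_center.
Qed.

Lemma rotate_to_real (z : C) : exists2 u : C, rn u <= 1 & complex.Re (u * z) = rn z.
Proof.
have [->|z0] := eqVneq z 0; first by exists 0; rewrite ?rn0 ?mul0r.
have nz := rn_gt0 z0.
exists (z^* * ((rn z)^-1)%:C).
  rewrite rnM rn_real ger0_norm ?invr_ge0 ?rn_ge0 //.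
  have -> : rn z^* = rn z.
    by rewrite /rn !normc_def; case: (z) => x y /=; rewrite sqrrN.
  by rewrite divff // lt0r_neq0.
have -> : z^* * ((rn z)^-1)%:C * z = (rn z)%:C.
  rewrite mulrAC (mulrC _ z) -sqr_normc normE -rmorphXn -rmorphM /=.
  by rewrite expr2 mulfK // lt0r_neq0.
by [].
Qed.

Lemma Re_is_derive (f : C -> C) (t : R) (k : C) : cderiv f t%:C k ->
  is_derive t (1 : R) (fun s : R => complex.Re (f s%:C)) (complex.Re k).
Proof.
move=> H.
have E : (fun s : R => s^-1 *: (((fun s : R =>
  complex.Re (f s%:C)) \o shift t) (s *: (1 : R)) - complex.Re (f t%:C))) @ 0^' -->
    complex.Re k.
  apply/cvgrPdist_lt => e e0.
  have e2 : 0 < e / 2 by lra.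
  have [r r0 hr] := H _ e2.
  rewrite near_withinE; apply/nbhs_normP; exists r => //= s.
  rewrite /ball_ /= sub0r normrN => sr s0.
  have := hr (s + t)%:C.
  have -> : (s + t)%:C - t%:C = s%:C :> C by rewrite -rmorphB /= addrK.
  rewrite rn_real => /(_ sr) h.
  have ns : 0 < `|s| by rewrite normr_gt0.
  rewrite -(ltr_pM2l ns) -normrM mulrBr [s *: 1]mulr1.
  rewrite [s^-1 *: _]/(s^-1 * _) mulVKf // -normrN opprB.
  apply: le_lt_trans (_ : e / 2 * `|s| < _); last by rewrite mulrC ltr_pM2l //; lra.
  apply: le_trans h; apply: le_trans (Re_le_rn _).
  by rewrite !ReB; case: (k) => x y /=; rewrite mulr0 subr0 (mulrC x).
by split; [apply/cvg_ex; exists (complex.Re k)|apply/cvg_lim].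
Qed.

(** A factor u rotates the increment of f to the real axis; the real mean value theorem then applies
    to Re (u f) - g, whose derivative is nonpositive. A variable majorant g lets Taylor remainders
    be integrated. *)
Lemma mean_value_ineq (f f' : C -> C) (g g' : R -> R) (s : R) : 0 <= s ->
  (forall t, 0 <= t <= s -> cderiv f t%:C (f' t%:C)) ->
  (forall t, 0 <= t <= s -> is_derive t (1 : R) g (g' t)) ->
  (forall t, 0 <= t <= s -> rn (f' t%:C) <= g' t) ->
  rn (f s%:C - f 0) <= g s - g 0.
Proof.
rewrite le_eqVlt => /predU1P[<- _ _ _|s0 df dg hb].
  by rewrite !subrr rn0.
have [u u1 hu] := rotate_to_real (f s%:C - f 0); rewrite -hu.
pose p (t : R) := complex.Re (u * f t%:C) - g t.
have dp t : 0 <= t <= s -> is_derive t (1 : R) p (complex.Re (u * f' t%:C) - g' t).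
  move=> ts; apply: is_deriveB; last exact: dg.
  apply: (Re_is_derive (f := fun z => u * f z)).
  apply/cderivP; apply: is_deriveZ; apply/cderivP; exact: df.
have cp : {within `[0, s], continuous p}.
  apply: continuous_in_subspaceT => x /set_mem /=; rewrite in_itv /= => /dp h.
  apply: differentiable_continuous; apply/derivable1_diffP; exact: ex_derive.
have [c cs hc] := @MVT _ p _ 0 s s0 (fun x xs => dp x (subset_itv_oo_cc xs)) cp.
have {cs} cs : 0 <= c <= s by have := subset_itv_oo_cc cs; rewrite in_itv.
have : p s - p 0 <= 0.
  rewrite hc subr0 pmulr_lle0 // subr_le0.
  apply: le_trans (hb c cs); apply: le_trans (ler_norm _) _.
  apply: le_trans (Re_le_rn _) _; rewrite rnM.
  by rewrite ler_piMl // rn_ge0.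
by rewrite /p mulrBr ReB; lra.
Qed.

End Holomorphic.

(** * Second-order estimates and uniform limits *)

Section QuadraticEstimate.
Context {R : realType}.
Implicit Types (V W : normedModType R[i]).
Local Notation C := (R[i]).

(** This is 200 * 200 * 4: a Lipschitz estimate for h, then one for its increments on a ball of
    radius r / 4. *)
Definition taylor2_const : R := 400 * 400.

Lemma taylor2_const_ge0 : 0 <= taylor2_const.
Proof. by apply: mulr_ge0; exact: ler0n. Qed.

Lemma rnball_convex V (a x y : V) (r t : R) : rnball a r x -> rnball a r y ->
  0 <= t <= 1 ->
  rnball a r (x + t%:C *: (y - x)).
Proof.
rewrite /rnball /= => xa ya /andP[t0 t1].
have -> : x + t%:C *: (y - x) - a = (1 - t)%:C *: (x - a) + t%:C *: (y - a).
  rewrite rmorphB /= scalerBl scale1r -(addrA (x - a)) (addrC (- _)) -scalerBr.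
  by rewrite opprB addrA subrK addrAC.
apply: le_lt_trans (rnD _ _) _; rewrite !rnZ !rn_real !ger0_norm //; last lra.
have [->|t10] := eqVneq t 0; first by rewrite subr0 mul1r mul0r addr0.
have t00 : 0 < t by rewrite lt_neqAle eq_sym t10.
have h1 : (1 - t) * rn (x - a) <= (1 - t) * r by apply: ler_wpM2l; lra.
have h2 : t * rn (y - a) < t * r by rewrite ltr_pM2l.
lra.
Qed.

Lemma mean_value_ball V (h : V -> C) (a x y : V) (r B : R) :
  (forall z, rnball a r z -> differentiable h z) ->
  (forall z, rnball a r z -> rn ('D_(y - x) h z) <= B) ->
  rnball a r x -> rnball a r y -> rn (h y - h x) <= B.
Proof.
move=> dh hB xa ya.
have := @mean_value_ineq _ (fun t => h (x + t *: (y - x)))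
  (fun t => 'D_(y - x) h (x + t *: (y - x))) (fun t => B * t) (fun _ => B) 1 ler01.
rewrite rmorph1 scale1r scale0r addr0 mulr1 mulr0 subr0 (addrC x) subrK; apply.
- by move=> t t1; apply: differentiable_line; apply: dh; exact: rnball_convex.
- move=> t _; have := is_deriveZ B (is_derive_id t (1 : R)).
  by rewrite [B *: 1]mulr1.
- by move=> t t1; apply: hB; exact: rnball_convex.
Qed.

Lemma lipschitz_ball V (h : V -> C) (a x y : V) (r M : R) : 0 < r ->
  (forall z, rnball a r z -> differentiable h z) ->
  (forall z, rnball a r z -> rn (h z) <= M) ->
  rnball a (r / 2) x -> rnball a (r / 2) y ->
    rn (h y - h x) <= 200 * M / r * rn (y - x).
Proof.
move=> r0 dh hM; have r2 : 0 < r / 2 by lra.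
have sub z : rnball a (r / 2) z -> rnball z (r / 2) `<=` rnball a r.
  by rewrite /rnball /= => za; apply: rnball_sub; lra.
have sub2 z : rnball a (r / 2) z -> rnball a r z by move=> /sub; apply;
  exact: rnball_center.
apply: mean_value_ball => [z /sub2/dh //|z za].
have -> : 200 * M / r * rn (y - x) = 100 * M * rn (y - x) / (r / 2) by field; lra.
by apply: derive_bound => // t /(sub _ za); [exact: dh|exact: hM].
Qed.

(* Lipschitz estimate for the increment of h, which is itself of size |w|. *)
Lemma second_difference V (h : V -> C) (a x y w : V) (r M : R) : 0 < r ->
  (forall z, rnball a r z -> differentiable h z) ->
  (forall z, rnball a r z -> rn (h z) <= M) ->
  rn w < r / 4 -> rnball a (r / 8) x -> rnball a (r / 8) y ->
  rn (h (y + w) - h y - (h (x + w) - h x)) <=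
  taylor2_const * M / r ^+ 2 * rn w * rn (y - x).
Proof.
move=> r0 dh hM wr xa ya.
have r2 : 0 < r / 4 by lra.
pose k z := h (z + w) - h z.
have sub z : rnball a (r / 4) z -> rnball a (r / 2) z /\ rnball a (r / 2) (z + w).
  rewrite /rnball /= => za; split; first lra.
  by rewrite addrAC; apply: le_lt_trans (rnD _ _) _; lra.
have sub2 z : rnball a (r / 2) z -> rnball a r z by rewrite /rnball /=; lra.
have e1 : taylor2_const * M / r ^+ 2 * rn w * rn (y - x) =
    200 * (200 * M / r * rn w) / (r / 4) * rn (y - x).
  by rewrite /taylor2_const; field; lra.
rewrite e1; apply: (lipschitz_ball (h := k) r2).
- move=> z /sub[z1 z2]; apply: differentiableB; last exact: dh (sub2 _ z1).
  have dsh : differentiable (fun z => z + w) z.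
    by apply: differentiableD => //; exact: differentiable_cst.
  by apply: (differentiable_comp dsh); exact: dh (sub2 _ z2).
- move=> z /sub[z1 z2]; have := lipschitz_ball r0 dh hM z1 z2.
  by rewrite addrAC subrr add0r.
- by move: xa; rewrite /rnball /=; lra.
- by move: ya; rewrite /rnball /=; lra.
Qed.

(** The second difference of step t v divided by a small t: a bound on h alone controls the
    variation of its derivative. *)
Lemma derive_lipschitz V (h : V -> C) (a x y v : V) (r M : R) : 0 < r ->
  (forall z, rnball a r z -> differentiable h z) ->
  (forall z, rnball a r z -> rn (h z) <= M) ->
  rnball a (r / 8) x -> rnball a (r / 8) y ->
  rn ('D_v h y - 'D_v h x) <= taylor2_const * M / r ^+ 2 * rn v * rn (y - x).
Proof.
move=> r0 dh hM xa ya.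
have sub z : rnball a (r / 8) z -> rnball a r z by rewrite /rnball /=; lra.
apply/ler_addgt0Pr => e e0; have e2 : 0 < e / 2 by lra.
have /(differentiable_derive v) /is_derive_rnP /(_ _ e2) [r1 r10 h1] := dh _ (sub _ xa).
have /(differentiable_derive v) /is_derive_rnP /(_ _ e2) [r2 r20 h2] := dh _ (sub _ ya).
(* Small enough for both first-order expansions and for |t v| < r / 4, as [second_difference]
   requires; the added 1 allows v = 0. *)
pose t := Num.min (Num.min (r1 / 2) (r2 / 2)) (r / (8 * (rn v + 1))).
have v0 := rn_ge0 v.
have t0 : 0 < t by rewrite /t !lt_min !divr_gt0 //; lra.
have t1 : t < r1 by apply: le_lt_trans (_ : r1 / 2 < _); rewrite ?ge_min ?lexx //; lra.
have t2 : t < r2.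
  by apply: le_lt_trans (_ : r2 / 2 < _); rewrite ?ge_min ?lexx ?orbT //; lra.
have tw : rn (t%:C *: v) < r / 4.
  rewrite rnZ rn_real gtr0_norm //.
  have : t <= r / (8 * (rn v + 1)) by rewrite ge_min lexx orbT.
  rewrite ler_pdivlMr; last lra.
  nra.
have nt : rn (t%:C : C) = t by rewrite rn_real gtr0_norm.
have := h1 t%:C; rewrite nt => /(_ t1) {}h1.
have := h2 t%:C; rewrite nt => /(_ t2) {}h2.
have h3 := second_difference r0 dh hM tw xa ya.
rewrite -(ler_pM2l t0) -{1}nt -rnM mulrBr.
set A := h (y + _) - h y in h2 h3; set B := h (x + _) - h x in h1 h3.
move: ('D_v h y) ('D_v h x) h1 h2 => dy dx h1 h2.
have scE (u : C) : t%:C *: u = t%:C * u by [].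
have -> : t%:C * dy - t%:C * dx = (A - B) - (A - t%:C *: dy) + (B - t%:C *: dx).
  by rewrite !scE; clearbody A B; ring.
apply: le_trans (rnD _ _) _; apply: le_trans (lerD (rnD _ _) (lexx _)) _.
rewrite rnN; rewrite rnZ nt in h3.
set X := _ * rn (y - x); set X' := _ * rn (y - x) in h3.
have -> : t * (X + e) = X' + e / 2 * t + e / 2 * t by rewrite /X /X'; field; lra.
by rewrite !lerD.
Qed.

(** Mean value inequality for h (a + t v) - t D_v h (a), whose derivative in t is controlled by
    [derive_lipschitz]. *)
Lemma taylor2 V (h : V -> C) (a v : V) (r M : R) : 0 < r ->
  (forall z, rnball a r z -> differentiable h z) ->
  (forall z, rnball a r z -> rn (h z) <= M) -> rn v < r / 8 ->
  rn (h (a + v) - h a - 'D_v h a) <= taylor2_const * M / r ^+ 2 * rn v ^+ 2.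
Proof.
move=> r0 dh hM vr.
have M0 : 0 <= M by apply: le_trans (rn_ge0 (h a)) (hM _ _); exact: rnball_center.
pose B := taylor2_const * M / r ^+ 2 * rn v ^+ 2.
have KM : 0 <= taylor2_const * M / r ^+ 2 := divr_ge0 (mulr_ge0 taylor2_const_ge0 M0)
  (sqr_ge0 r).
have inB (t : R) : 0 <= t <= 1 -> rn (t%:C *: v) <= rn v.
  by move=> /andP[t0 t1]; rewrite rnZ rn_real ger0_norm // ler_piMl // rn_ge0.
have inB8 (t : R) : 0 <= t <= 1 -> rnball a (r / 8) (a + t%:C *: v).
  by move=> /inB t1; rewrite /rnball /= addrAC subrr add0r; lra.
have := @mean_value_ineq _ (fun t => h (a + t *: v) - t * 'D_v h a)
  (fun t => 'D_v h (a + t *: v) - 'D_v h a) (fun t => B * t) (fun _ => B) 1 ler01.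
rewrite rmorph1 scale1r scale0r addr0 mulr1 mul1r mul0r subr0 mulr0 subr0.
rewrite (addrAC (h (a + v))); apply.
- move=> t t1; apply/cderivP; apply: is_deriveB.
    apply/cderivP; apply: differentiable_line; apply: dh.
    by have := inB8 t t1; rewrite /rnball /=; lra.
  have := is_deriveM (is_derive_id (t%:C : C) (1 : C)) (is_derive_cst ('D_v h a) (t%:C
    : C) (1 : C)).
  by rewrite scaler0 add0r [_ *: 1]mulr1.
- move=> t _; have := is_deriveZ B (is_derive_id t (1 : R)).
  by rewrite [B *: 1]mulr1.
- move=> t t1; have a8 : rnball a (r / 8) a by apply: rnball_center; lra.
  apply: le_trans (derive_lipschitz v r0 dh hM a8 (inB8 t t1)) _.
  rewrite /B addrAC subrr add0r expr2 mulrA; apply: ler_wpM2l; last exact: inB.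
  by rewrite mulr_ge0 ?rn_ge0.
Qed.

End QuadraticEstimate.

(** * Uniform limits of holomorphic functions *)

Section UniformLimits.
Context {R : realType}.
Implicit Types (V W : normedModType R[i]).
Local Notation C := (R[i]).

Lemma cvg_seqP W (u : nat -> W) (y : W) : u @ \oo --> y <->
  forall e : R, 0 < e -> exists N, forall m, (N <= m)%N -> rn (u m - y) <= e.
Proof.
rewrite cvg_rnP; split=> H e e0.
  by have [N _ hN] := H e e0; exists N => m /hN /ltW.
have e2 : 0 < e / 2 by lra.
have [N hN] := H _ e2; exists N => // m /= /hN; lra.
Qed.

Lemma lim_rn_le W (u : nat -> W) (y : W) (B : R) N : u @ \oo --> y ->
  (forall m, (N <= m)%N -> rn (u m) <= B) -> rn y <= B.
Proof.
move=> /cvg_seqP uy uB; apply/ler_addgt0Pr => e /uy[N' hN].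
have := rnD (y - u (maxn N N')) (u (maxn N N')); rewrite subrK rnB.
have := uB (maxn N N') (leq_maxl _ _); have := hN (maxn N N') (leq_maxr _ _); lra.
Qed.

Lemma complex_complete (u : nat -> C) :
  (forall e : R, 0 < e -> exists N, forall m p, (N <= m)%N -> (N <= p)%N ->
     rn (u m - u p) <= e) -> exists l : C, u @ \oo --> l.
Proof.
move=> H.
have real_cvg (f : nat -> R) : (forall m p, `|f m - f p| <= rn (u m - u p)) ->
    exists l, forall e, 0 < e -> exists N, forall m, (N <= m)%N -> `|f m - l| <= e.
  move=> hf.
  have : cvg (f @ \oo).
    apply/cauchy_cvgP/cauchy_exP => e e0.
    have e2 : 0 < e / 2 by lra.
    have [N hN] := H _ e2.
    exists (f N); exists N => // m /= Nm; rewrite /ball /= /ball_ /=.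
    by apply: le_lt_trans (hf _ _) _; apply: le_lt_trans (hN _ _ _ _) _ => //; lra.
  move=> /cvg_ex[l hl]; exists l => e e0.
  have /cvgrPdist_le/(_ _ e0)[N _ hN] := hl.
  by exists N => m /hN /=; rewrite distrC.
have [x hx] := real_cvg (fun m => complex.Re (u m))
  (fun m p => eq_ind _ (fun z => `|z| <= _) (Re_le_rn _) _ (ReB _ _)).
have [y hy] := real_cvg (fun m => complex.Im (u m))
  (fun m p => eq_ind _ (fun z => `|z| <= _) (Im_le_rn _) _ (ImB _ _)).
exists (x +i* y); apply/cvg_seqP => e e0.
have e2 : 0 < e / 2 by lra.
have [N hN] := hx _ e2; have [N' hN'] := hy _ e2.
exists (maxn N N') => m; rewrite geq_max => /andP[/hN h1 /hN' h2].
apply: le_trans (rn_le_ReIm _) _; rewrite ReB ImB /=; lra.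
Qed.

(** By [derive_bound] the derivatives at a form Cauchy sequences; their limit L is linear and
    bounded, and [taylor2], with a bound M common to all large m, identifies L as the differential
    of h. *)
Lemma uniform_limit V (hs : nat -> V -> C) (h : V -> C) (a : V) (r : R) : 0 < r ->
  (forall m x, rnball a r x -> differentiable (hs m) x) ->
  (forall e : R, 0 < e -> exists N, forall m, (N <= m)%N ->
     forall x, rnball a r x -> rn (hs m x - h x) <= e) ->
  differentiable h a /\ forall v, 'D_v (hs m) a @[m --> \oo] --> 'D_v h a.
Proof.
move=> r0 dh unif.
have aa : rnball a r a by exact: rnball_center.
have [N0 hN0] := unif _ (ltr01 : (0 : R) < 1).
have /continuous_rnP/(_ _ ltr01) [r' r'0 hr'] := differentiable_continuous (dh N0 _ aa).
pose r1 := Num.min r r'.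
have r10 : 0 < r1 by rewrite lt_min r0.
have r1r x : rnball a r1 x -> rnball a r x.
  by rewrite /rnball /= => h1; apply: lt_le_trans h1 _; rewrite ge_min lexx.
(* One unit for the continuity of [hs N0] at a, two for passing from [hs m] to h and from h to
   [hs N0]. *)
pose M := rn (hs N0 a) + 3.
have hM m x : (N0 <= m)%N -> rnball a r1 x -> rn (hs m x) <= M.
  move=> mN xa; have xr := r1r _ xa.
  have h1 : rn (hs N0 x - hs N0 a) < 1.
    by apply: hr'; move: xa; rewrite /rnball /= => xa; apply: lt_le_trans xa _;
      rewrite ge_min lexx orbT.
  have h2 := hN0 m mN x xr; have h3 := hN0 N0 (leqnn _) x xr.
  have h4 := rn_tri (hs m x) (h x) (hs N0 x); rewrite (rnB (h x)) in h4.
  have h5 := rnD (hs m x - hs N0 x) (hs N0 x - hs N0 a + hs N0 a).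
  rewrite !subrK in h5.
  have := rnD (hs N0 x - hs N0 a) (hs N0 a); rewrite subrK => h6.
  rewrite /M; lra.
have M0 : 0 <= M by have := rn_ge0 (hs N0 a); rewrite /M; lra.
have dh1 m x : rnball a r1 x -> differentiable (hs m) x by move=> /r1r; exact: dh.
have dE m v : 'd (hs m) a v = 'D_v (hs m) a.
  by rewrite deriveE //; exact: dh.
have limD v : exists l : C, 'D_v (hs m) a @[m --> \oo] --> l.
  apply: complex_complete => e e0.
  have v0 := rn_ge0 v.
  have e1 : 0 < e * r1 / (200 * (rn v + 1)) by apply: divr_gt0;
    [exact: mulr_gt0|apply: mulr_gt0; [exact: ltr0n|lra]].
  have [N hN] := unif _ e1; exists N => m p mN pN.
  suff : rn ('D_v (hs m) a - 'D_v (hs p) a) <= e by [].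
  have <- : 'D_v (hs m - hs p) a = 'D_v (hs m) a - 'D_v (hs p) a.
    by apply: deriveB; apply: diff_derivable; exact: dh.
  apply: le_trans (derive_bound (M := 2 * (e * r1 / (200 * (rn v + 1)))) v r10 _ _) _.
  - by move=> x xa; apply: differentiableB; exact: dh1.
  - move=> x /r1r xa; have h1 := hN m mN x xa; have h2 := hN p pN x xa.
    have := rn_tri (hs m x) (h x) (hs p x); rewrite (rnB (h x)).
    set X := _ / _ in h1 h2 *; move: h1 h2; rewrite /= -[rn ((hs m - hs p) x)]/(rn (hs
      m x - hs p x)).
    lra.
  have -> : 100 * (2 * (e * r1 / (200 * (rn v + 1)))) * rn v / r1 = e * (rn v / (rn v +
    1)).
    by field; lra.
  by apply: ler_piMr; [exact: ltW|rewrite ler_pdivrMr; lra].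
have [L hL] := choice limD.
have Llin : linear L.
  move=> k u v; apply: (cvg_unique _ (hL _)) => //.
  have -> : (fun m => 'D_(k *: u + v) (hs m) a) =
      (fun m => k *: 'D_u (hs m) a + 'D_v (hs m) a).
    by apply/funext => m; rewrite -!dE linearP.
  by apply: cvgD; [apply: cvgZr; exact: hL|exact: hL].
pose Lm : {linear V -> C} := HB.pack L (GRing.isLinear.Build _ _ _ _ L Llin).
have Lb v : rn (L v) <= (100 * M / r1) * rn v.
  rewrite mulrAC; apply: (lim_rn_le (N := N0) (hL v)) => m mN.
  exact: (derive_bound v r10 (dh1 m) (fun x => hM m x mN)).
have cvh x : rnball a r x -> hs m x @[m --> \oo] --> h x.
  by move=> xa; apply/cvg_seqP => e /unif[N hN]; exists N => m /hN; exact.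
have quad v : rn v < r1 / 8 -> rn (h (a + v) - h a - L v) <= taylor2_const * M / r1 ^+
  2 * rn v ^+ 2.
  move=> vr.
  have av : rnball a r (a + v) by apply: r1r; rewrite /rnball /= addrAC subrr add0r;
    lra.
  have c : hs m (a + v) - hs m a - 'D_v (hs m) a @[m --> \oo] --> h (a + v) - h a - L v.
    by apply: cvgB; [apply: cvgB; exact: cvh|exact: hL].
  apply: (lim_rn_le (N := N0) c) => m mN.
  exact: (taylor2 r10 (dh1 m) (fun x => hM m x mN) vr).
have KM : 0 <= taylor2_const * M / r1 ^+ 2 :=
  divr_ge0 (mulr_ge0 taylor2_const_ge0 M0) (sqr_ge0 r1).
have [dha dhE] : differentiable h a /\ 'd h a = Lm :> (V -> C).
  apply: (differentiable_of_rn (C := 100 * M / r1)) => // e e0.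
  set K := taylor2_const * M / r1 ^+ 2 in KM quad.
  exists (Num.min (r1 / 8) (e / (K + 1))); first by rewrite lt_min !divr_gt0 //; lra.
  move=> v; rewrite lt_min => /andP[h1]; rewrite ltr_pdivlMr => [h2|]; last lra.
  apply: le_trans (quad v h1) _.
  have := rn_ge0 v; nra.
split; first exact: dha.
move=> v; have -> : 'D_v h a = L v by rewrite (deriveE _ dha) dhE.
exact: hL.
Qed.

End UniformLimits.

(** * Holomorphic functions with vanishing derivatives in prescribed directions *)

Section IteratedDerivatives.
Context {R : realType} {V : normedModType R[i]}.
Local Notation C := (R[i]).
Implicit Types (U : set V) (h : V -> C).

(* The i-th component of a C^n-holomorphic map is the case where E consists of
   the coordinate directions of the blocks j <> i. *)
Definition holE (E : set V) U h :=
  forall x, U x -> differentiable h x /\ forall e, E e -> 'D_e h x = 0.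

Lemma holE_sub E U U' h : U' `<=` U -> holE E U h -> holE E U' h.
Proof. by move=> UU H x /UU /H. Qed.

Lemma eq_holE E U h1 h2 : h1 =1 h2 -> holE E U h1 -> holE E U h2.
Proof. by move=> /funext ->. Qed.

Lemma holE_cst E U (c : C) : holE E U (cst c).
Proof. by move=> x _; split=> [|e _]; [exact: differentiable_cst|exact: derive_cst].
  Qed.

Lemma holED E U h1 h2 : holE E U h1 -> holE E U h2 -> holE E U (fun x => h1 x + h2 x).
Proof.
move=> H1 H2 x Ux; have [d1 e1] := H1 x Ux; have [d2 e2] := H2 x Ux.
split=> [|e Ee]; first exact: differentiableD.
have := deriveD (diff_derivable (v := e) d1) (diff_derivable (v := e) d2).
by rewrite e1 // e2 // addr0.
Qed.

Lemma holEM E U h1 h2 : holE E U h1 -> holE E U h2 -> holE E U (fun x => h1 x * h2 x).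
Proof.
move=> H1 H2 x Ux; have [d1 e1] := H1 x Ux; have [d2 e2] := H2 x Ux.
split=> [|e Ee]; first exact: differentiableM.
have := deriveM (diff_derivable (v := e) d1) (diff_derivable (v := e) d2).
by rewrite e1 // e2 // !scaler0 addr0.
Qed.

Lemma holEZ E U (c : C) h : holE E U h -> holE E U (fun x => c * h x).
Proof. by move=> H; exact: (holEM (@holE_cst E U c) H). Qed.

Lemma holEB E U h1 h2 : holE E U h1 -> holE E U h2 -> holE E U (fun x => h1 x - h2 x).
Proof.
move=> H1 H2; have /(holED H1) := holEZ (-1) H2.
by congr holE; apply/funext => x; rewrite mulN1r.
Qed.

Lemma holE_sum E U n (hs : nat -> V -> C) : (forall k, (k < n)%N -> holE E U (hs k)) ->
  holE E U (fun x => \sum_(k < n) hs k x).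
Proof.
elim: n => [|n IH] H.
  by under eq_fun do rewrite big_ord0; exact: holE_cst.
under eq_fun do rewrite big_ord_recr /=.
by apply: holED; [apply: IH => k kn; apply: H; exact: ltnW|exact: H].
Qed.

(** A homothety followed by a translation only rescales each direction, so the directions of E are
    preserved. *)
Lemma holE_affine E U h (a : V) (t : C) : holE E U h ->
  holE E [set v | U (a + t *: v)] (fun v => h (a + t *: v)).
Proof.
move=> H v /= /H[dh hE]; split=> [|e /hE De].
  have da : differentiable (fun v : V => a + t *: v) v.
    by apply: differentiableD; [exact: differentiable_cst|exact: differentiableZ].
  exact: (differentiable_comp da).
have := differentiable_derive e dh; rewrite De => /is_derive_rnP H1.
suff H2 : is_derive v e (fun v => h (a + t *: v)) 0 by exact: derive_val.
apply/is_derive_rnP => eps eps0.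
have t1 : 0 < rn t + 1 by have := rn_ge0 t; lra.
have [r r0 hr] := H1 _ (divr_gt0 eps0 t1).
exists (r / (rn t + 1)); first exact: divr_gt0.
move=> s; rewrite ltr_pdivlMr // mulrC => sr.
have ts : rn (t * s) <= (rn t + 1) * rn s.
  by rewrite rnM ler_wpM2r ?rn_ge0 //; lra.
have := hr (t * s) (le_lt_trans ts sr).
rewrite !scaler0 !subr0 scalerDr scalerA (addrA a) => hh; apply: le_trans hh _.
apply: le_trans (ler_wpM2l _ ts) _; first by rewrite divr_ge0 // ltW.
by rewrite mulrA divfK // lt0r_neq0.
Qed.

Lemma locally_bounded h (a : V) : {for a, continuous h} ->
  exists2 r : R, 0 < r & forall x, rnball a r x -> rn (h x) <= rn (h a) + 1.
Proof.
move=> /continuous_rnP /(_ _ ltr01)[r r0 hr]; exists r => // x /hr h1.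
have := rnD (h x - h a) (h a); rewrite subrK; lra.
Qed.

Lemma small_inv (e : R) : 0 < e -> exists N, forall m, (N <= m)%N -> (m.+1%:R)^-1 < e.
Proof.
move=> e0; exists (Num.truncn e^-1) => m Nm.
rewrite invf_plt ?posrE //; apply: lt_le_trans (truncnS_gt _) _.
by rewrite ler_nat.
Qed.

(** Holomorphy is asked of [hs m] only from some rank on, which depends on the point: difference
    quotients of a function on U make sense near a only once their step is small. *)
Lemma holE_limit E U h (hs : nat -> V -> C) : 
  (forall a, U a -> exists2 r : R, 0 < r & 
     exists2 N, (forall m, (N <= m)%N -> holE E (rnball a r) (hs m)) &
     forall e : R, 0 < e -> exists N', forall m, (N' <= m)%N ->
     forall x, rnball a r x -> rn (hs m x - h x) <= e) -> holE E U h.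
Proof.
move=> H a /H[r r0 [N hN unif]].
have [] := @uniform_limit _ _ (fun m => hs (N + m)%N) h a r r0.
- by move=> m x xa; have [] := hN (N + m)%N (leq_addr _ _) x xa.
- move=> e /unif[N' hN']; exists N' => m mN x; apply: hN'.
  by apply: leq_trans mN _; exact: leq_addl.
move=> dh cv; split=> // e Ee.
apply: (cvg_unique _ (cv e)) => //.
have -> : (fun m => 'D_e (hs (N + m)%N) a) = fun=> 0.
  apply/funext => m; have [] := hN (N + m)%N (leq_addr _ _) a (rnball_center _ r0).
  by move=> _; exact.
exact: cvg_cst.
Qed.

(** The quotients of step 1 / (m + 1) are built from h and a translate of it, so they inherit the
    vanishing along E; by [taylor2] they converge locally uniformly, with error at most K / (m +
    1). *)
Lemma holE_derive E U h (v : V) : open U -> holE E U h -> holE E U ('D_v h).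
Proof.
move=> oU H; pose t m : R := (m.+1%:R)^-1.
have t0 m : 0 < t m by rewrite invr_gt0.
apply: (holE_limit (hs := fun m x => (t m)^-1%:C * (h (x + (t m)%:C *: v) - h x))).
move=> a Ua.
have [r1 r10 hr1] := open_rnP oU Ua.
have [r2 r20 hr2] := locally_bounded (differentiable_continuous (H a Ua).1).
set M := rn (h a) + 1 in hr2.
pose r := Num.min r1 r2.
have r0 : 0 < r by rewrite lt_min r10.
have rU x : rnball a r x -> U x.
  by rewrite /rnball /= lt_min => /andP[/hr1].
have rM x : rnball a r x -> rn (h x) <= M.
  by rewrite /rnball /= lt_min => /andP[_ /hr2].
have r2' : 0 < r / 2 by lra.
have v1 : 0 < rn v + 1 by have := rn_ge0 v; lra.
have sub x : rnball a (r / 2) x -> rnball x (r / 2) `<=` rnball a r.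
  by rewrite /rnball /= => xa; apply: rnball_sub; lra.
have tv e m : t m < e / (rn v + 1) -> rn ((t m)%:C *: v) < e.
  rewrite ltr_pdivlMr // rnZ rn_real gtr0_norm // => h1.
  by apply: le_lt_trans h1; rewrite ler_pM2l //; lra.
exists (r / 2) => //.
(* The bound r / 16 is (r / 2) / 8, the range of [taylor2] on balls of radius r / 2. *)
have [N hN] := small_inv (divr_gt0 (divr_gt0 r0 (ltr0n _ 16 : 0 < 16%:R)) v1).
have tN m : (N <= m)%N -> rn ((t m)%:C *: v) < r / 16 by move=> /hN /tv.
have HB : holE E (rnball a r) h by exact: holE_sub H.
exists N.
  move=> m mN; apply: holEZ.
  have h1 : holE E (rnball a (r / 2)) h.
    by apply: (holE_sub _ HB) => x /sub; apply; exact: rnball_center.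
  have h2 : holE E (rnball a (r / 2)) (fun x => h (x + (t m)%:C *: v)).
    have := @holE_affine E _ h ((t m)%:C *: v) 1 HB.
    have -> : (fun x => h ((t m)%:C *: v + 1 *: x)) = (fun x => h (x + (t m)%:C *: v)).
      by apply/funext => x; rewrite scale1r addrC.
    apply: holE_sub => x xa /=; rewrite scale1r addrC; apply: (sub _ xa).
    by rewrite /rnball /= addrAC subrr add0r; have := tN m mN; lra.
  exact: (holEB h2 h1).
move=> e e0.
set K := taylor2_const * M / (r / 2) ^+ 2 * rn v ^+ 2.
have M0 : 0 <= M by apply: le_trans (rn_ge0 (h a)) (rM _ (rnball_center _ r0)).
have K0 : 0 <= K.
  exact: mulr_ge0 (divr_ge0 (mulr_ge0 taylor2_const_ge0 M0) (sqr_ge0 _)) (sqr_ge0 _).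
have K1 : 0 < K + 1 by lra.
have [N' hN'] := small_inv (divr_gt0 e0 K1).
exists (maxn N N') => m; rewrite geq_max => /andP[/tN mN /hN' mN'] x xa.
have dx z : rnball x (r / 2) z -> differentiable h z by move=> /(sub _ xa)/HB[].
have := taylor2 r2' dx (fun z hz => rM z (sub _ xa z hz)) (_ : _ < r / 2 / 8).
move=> /(_ ((t m)%:C *: v)).
have -> : 'D_((t m)%:C *: v) h x = (t m)%:C *: 'D_v h x.
  have dhx : differentiable h x by apply: dx; exact: rnball_center.
  by rewrite !deriveE // linearZ.
rewrite rnZ rn_real (gtr0_norm (t0 m)) => hh.
have {}hh : rn (h (x + (t m)%:C *: v) - h x - (t m)%:C *: 'D_v h x) <= K * t m ^+ 2.
  have -> : K * t m ^+ 2 = taylor2_const * M / (r / 2) ^+ 2 * (t m * rn v) ^+ 2.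
    by rewrite /K exprMn; ring.
  by apply: hh; move: mN; rewrite rnZ rn_real (gtr0_norm (t0 m)); lra.
have tC : (t m)%:C != 0 :> C.
  by apply: contra_neq (lt0r_neq0 (t0 m)) => /complexI.
have -> : (t m)^-1%:C * (h (x + (t m)%:C *: v) - h x) - 'D_v h x =
   (t m)^-1%:C * (h (x + (t m)%:C *: v) - h x - (t m)%:C *: 'D_v h x).
  rewrite [RHS]mulrBr; congr (_ - _).
  by rewrite fmorphV /= -[_ *: _]/(_ * _) mulKf.
rewrite rnM rn_real ger0_norm ?invr_ge0 ?(ltW (t0 m)) //.
have ti : 0 <= (t m)^-1 by rewrite invr_ge0 ltW.
apply: le_trans (ler_wpM2l ti hh) _.
have -> : (t m)^-1 * (K * t m ^+ 2) = K * t m by field; rewrite lt0r_neq0.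
move: mN'; rewrite ltr_pdivlMr // -/(t m) => h2.
have := t0 m; nra.
Qed.

End IteratedDerivatives.

(** * Taylor expansions and the identity theorem *)

Section Taylor.
Context {R : realType} {V : normedModType R[i]}.
Local Notation C := (R[i]).
Implicit Types (E U : set V) (h : V -> C).

Definition iterD (v : V) k h := iter k (fun g => 'D_v g) h.

Lemma iterDS v k h : iterD v k.+1 h = 'D_v (iterD v k h).
Proof. by []. Qed.

Lemma iterDSr v k h : iterD v k.+1 h = iterD v k ('D_v h).
Proof. exact: iterSr. Qed.

Lemma holE_iterD E U h v k : open U -> holE E U h -> holE E U (iterD v k h).
Proof. move=> oU H; elim: k => [|k IH]; [exact: H|exact: (holE_derive v oU IH)]. Qed.

(** Induction from (1 + 1/k)^k <= e. It absorbs the k^k of the iterated Cauchy estimate into the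
    Taylor denominators. *)
Lemma expn_le_fact k : k%:R ^+ k <= expR 1 ^+ k * k`!%:R :> R.
Proof.
elim: k => [|k IH]; first by rewrite !expr0 mul1r.
have e0 : 0 < expR 1 :> R by exact: expR_gt0.
have step : k.+1%:R ^+ k <= expR 1 * k%:R ^+ k :> R.
  case: k {IH} => [|k]; first by rewrite !expr0 mulr1; have := expR_ge1Dx (1 : R); lra.
  have k0 : 0 < k.+1%:R :> R by exact: ltr0n.
  have -> : expR (1 : R) = expR (k.+1%:R^-1) ^+ k.+1.
    by rewrite -expRM_natl divff // lt0r_neq0.
  rewrite -exprMn; apply: lerXn2r; rewrite ?nnegrE ?ler0n ?mulr_ge0 ?expR_ge0 ?ler0n //.
  have := ler_wpM2r (ltW k0) (expR_ge1Dx (k.+1%:R^-1 : R)).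
  by rewrite mulrDl mul1r mulVf ?lt0r_neq0 // -(natr1 k.+1).
rewrite factS natrM exprSr exprS.
have -> : expR 1 * expR 1 ^+ k * (k.+1%:R * k`!%:R) =
  expR 1 * (expR 1 ^+ k * k`!%:R) * k.+1%:R :> R by ring.
apply: ler_wpM2r; first exact: ler0n.
by apply: le_trans step _; rewrite ler_pM2l.
Qed.

(** 100 comes from the Cauchy estimate, e from [expn_le_fact]. *)
Definition taylor_const : R := 100 * expR 1.

Lemma taylor_const_gt0 : 0 < taylor_const.
Proof. by apply: mulr_gt0; [exact: ltr0n|exact: expR_gt0]. Qed.

Lemma taylor_const_fact k (x : R) : 0 <= x ->
  (100 * k%:R * x) ^+ k / k`!%:R <= (taylor_const * x) ^+ k.
Proof.
move=> x0; rewrite ler_pdivrMr ?ltr0n ?fact_gt0 //.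
have -> : 100 * k%:R * x = (100 * x) * k%:R by rewrite mulrAC.
have -> : taylor_const * x = (100 * x) * expR 1 by rewrite /taylor_const mulrAC.
rewrite !(exprMn k (100 * x)) -(mulrA ((100 * x) ^+ k)).
apply: ler_wpM2l; last exact: expn_le_fact.
by apply: exprn_ge0; apply: mulr_ge0 => //; exact: ler0n.
Qed.

(** Each of the k derivatives spends r / k of the radius, whence a factor k in each Cauchy
    estimate. *)
Lemma iterD_bound E h (a v : V) (r M : R) k : 0 < r -> holE E (rnball a r) h ->
  (forall x, rnball a r x -> rn (h x) <= M) ->
  rn (iterD v k h a) <= (100 * k%:R * (rn v / r)) ^+ k * M.
Proof.
move=> r0 H hM; case: k => [|k].
  by rewrite expr0 mul1r; apply: hM; exact: rnball_center.
have k0 : 0 < k.+1%:R :> R by exact: ltr0n.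
pose s := r / k.+1%:R; have s0 : 0 < s by exact: divr_gt0.
(* The induction moves the centre: j derivatives at x require a margin of j s around x. *)
have key j x : rnball a r x -> rn (x - a) + j%:R * s <= r ->
    rn (iterD v j h x) <= (100 * (rn v / s)) ^+ j * M.
  elim: j x => [|j IH] x xa; first by rewrite expr0 mul1r => _; exact: hM.
  rewrite -natr1 mulrDl mul1r => xj.
  have js : 0 <= j%:R * s by rewrite mulr_ge0 ?ler0n // ltW.
  have sub : rnball x s `<=` rnball a r by apply: rnball_sub; lra.
  have := @derive_bound _ _ (iterD v j h) x v s ((100 * (rn v / s)) ^+ j * M) s0.
  rewrite exprSr.
  have -> : 100 * ((100 * (rn v / s)) ^+ j * M) * rn v / s =
    (100 * (rn v / s)) ^+ j * (100 * (rn v / s)) * M by ring.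
  apply.
    by move=> y /sub ya; have [] := holE_iterD v j (@open_rnball _ _ a r) H ya.
  move=> y yx; apply: IH; first exact: sub.
  have := rn_tri y x a; move: yx; rewrite /rnball /=; lra.
have := key k.+1 a (rnball_center _ r0).
rewrite subrr rn0 add0r.
have -> : k.+1%:R * s = r by rewrite /s mulrC divfK // lt0r_neq0.
have -> : 100 * (rn v / s) = 100 * k.+1%:R * (rn v / r).
  by rewrite /s; field; rewrite !lt0r_neq0.
by apply.
Qed.

(** Stated over any field, to serve the complex Taylor sums and their real majorant alike. *)
Lemma is_derive_monomial (F : numFieldType) k (x c : F) :
  is_derive x (1 : F) (fun z => z ^+ k.+1 / (k.+1)`!%:R * c) (x ^+ k / k`!%:R * c).
Proof.
have k0 : k.+1%:R != 0 :> F by rewrite pnatr_eq0.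
have f0 : k`!%:R != 0 :> F by rewrite pnatr_eq0 -lt0n fact_gt0.
have e : is_derive x (1 : F) (fun z => z ^+ k.+1) (k.+1%:R * x ^+ k).
  split; first exact: exprn_derivable.
  by rewrite exp_derive [_ *: 1]mulr1.
have := is_deriveZ ((k.+1)`!%:R^-1 * c) e.
have -> : ((k.+1)`!%:R^-1 * c) *: (k.+1%:R * x ^+ k) = x ^+ k / k`!%:R * c.
  by rewrite -[_ *: _]/(_ * _) factS natrM; field; rewrite f0 addrC natr1.
congr is_derive; apply/funext => z /=.
by rewrite -[_ *: _]/(_ * _) [LHS]mulrC mulrA.
Qed.

Lemma cderivD (f g : C -> C) z k l : cderiv f z k -> cderiv g z l ->
  cderiv (fun z => f z + g z) z (k + l).
Proof.
by move=> /cderivP hf /cderivP hg; apply/cderivP; exact: is_deriveD.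
Qed.

Lemma cderiv_sum (f : nat -> C -> C) (k : nat -> C) z n :
  (forall j, cderiv (f j) z (k j)) ->
  cderiv (fun z => \sum_(j < n) f j z) z (\sum_(j < n) k j).
Proof.
move=> H; elim: n => [|n IH].
  rewrite big_ord0; under eq_fun do rewrite big_ord0.
  by apply/cderivP; exact: is_derive_cst.
by rewrite big_ord_recr /=; under eq_fun do rewrite big_ord_recr /=; exact: cderivD.
Qed.

Definition taylor_sum h a v N (s : C) : C :=
  \sum_(k < N) (s ^+ k / k`!%:R * iterD v k h a).

(** The derivative of the remainder of order N + 1 of h is the remainder of order N of D_v h; the
    mean value inequality integrates s^N / N! to the next power. *)
Lemma taylor_remainder E U h (a v : V) N (B S : R) : open U -> holE E U h ->
  (forall t, 0 <= t <= S -> U (a + t%:C *: v)) ->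
  (forall t, 0 <= t <= S -> rn (iterD v N h (a + t%:C *: v)) <= B) ->
  forall s, 0 <= s <= S ->
  rn (h (a + s%:C *: v) - taylor_sum h a v N s%:C) <= s ^+ N / N`!%:R * B.
Proof.
move=> oU H inU; elim: N h H => [|N IH] h H hB s sS.
  by rewrite /taylor_sum big_ord0 subr0 expr0 fact0 divr1 mul1r; exact: hB.
have H' := holE_derive v oU H.
rewrite iterDSr in hB.
pose f z := h (a + z *: v) - taylor_sum h a v N.+1 z.
pose f' z := 'D_v h (a + z *: v) - taylor_sum ('D_v h) a v N z.
have f0 : f 0 = 0.
  rewrite /f /taylor_sum big_ord_recl /= scale0r addr0 expr0 fact0 divr1 mul1r.
  rewrite big1 ?addr0 ?subrr // => i _.
  by rewrite expr0n /= mul0r mul0r.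
have fE z : f z = h (a + z *: v) + (- h a + \sum_(k < N) (z ^+ k.+1 / (k.+1)`!%:R * -
  iterD v k.+1 h a)).
  rewrite /f /taylor_sum big_ord_recl /= expr0 fact0 divr1 mul1r opprD.
  by congr (_ + (_ + _)); rewrite -sumrN; apply: eq_bigr => i _; rewrite mulrN.
have df t : 0 <= t <= S -> cderiv f t%:C (f' t%:C).
  move=> tS; have -> : f' t%:C = 'D_v h (a + t%:C *: v) + (0 +
      \sum_(k < N) (t%:C ^+ k / k`!%:R * - iterD v k.+1 h a)).
    rewrite /f' /taylor_sum add0r; congr (_ + _); rewrite -sumrN.
    by apply: eq_bigr => i _; rewrite mulrN iterDSr.
  have -> : f = fun z => h (a + z *: v) + (- h a +
      \sum_(k < N) (z ^+ k.+1 / (k.+1)`!%:R * - iterD v k.+1 h a)) by apply/funext.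
  apply: cderivD.
    by apply: differentiable_line; have [] := H _ (inU _ tS).
  apply: cderivD; first by apply/cderivP; exact: is_derive_cst.
  apply: (cderiv_sum (f := fun k z => z ^+ k.+1 / (k.+1)`!%:R * - iterD v k.+1 h a)
   (k := fun k => t%:C ^+ k / k`!%:R * - iterD v k.+1 h a)) => k.
  by apply/cderivP; exact: is_derive_monomial.
have [s0 s1] : 0 <= s /\ s <= S by apply/andP.
have := @mean_value_ineq _ f f' (fun t => t ^+ N.+1 / (N.+1)`!%:R * B)
  (fun t => t ^+ N / N`!%:R * B) s s0.
rewrite f0 subr0 expr0n /= !mul0r subr0; apply.
- by move=> t /andP[t0 ts]; apply: df; rewrite t0 (le_trans ts).
- by move=> t _; exact: is_derive_monomial.
- move=> t /andP[t0 ts]; apply: (IH _ H' hB); by rewrite t0 (le_trans ts).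
Qed.

End Taylor.

(** * Convergence of Taylor series, continuation and the identity theorem *)

Section Series.
Context {R : realType} {V : normedModType R[i]}.
Local Notation C := (R[i]).
Implicit Types (E U : set V) (h : V -> C).

Lemma expr_half_small (e M : R) : 0 < e -> exists N, forall m, (N <= m)%N ->
  (1 / 2) ^+ m * M <= e.
Proof.
move=> e0.
have M1 : 0 < `|M| + 1 by have := normr_ge0 M; lra.
have [N hN] := small_inv (divr_gt0 e0 M1); exists N => m /hN.
rewrite ltr_pdivlMr // => h.
have p0 : 0 < (1 / 2 : R) ^+ m by rewrite exprn_gt0 //; lra.
have : (1 / 2 : R) ^+ m <= m.+1%:R^-1.
  have -> : (1 / 2 : R) ^+ m = (2 ^+ m)^-1 by rewrite div1r exprVn.
  rewrite lef_pV2 ?posrE ?ltr0n ?exprn_gt0 // -natrX ler_nat; exact: ltn_expl.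
move=> h2; apply/ltW/(le_lt_trans _ h).
apply: (le_trans (_ : _ <= (1 / 2) ^+ m * (`|M| + 1))).
  by rewrite ler_pM2l //; have := ler_norm M; lra.
by rewrite ler_pM2r.
Qed.

Lemma iterD_ball E h (a v x : V) (r M : R) k : 0 < r -> holE E (rnball a r) h ->
  (forall x, rnball a r x -> rn (h x) <= M) -> rnball a (r / 2) x ->
  rn (iterD v k h x) <= (100 * k%:R * (rn v / (r / 2))) ^+ k * M.
Proof.
move=> r0 H hM xa; have r2 : 0 < r / 2 by lra.
have sub : rnball x (r / 2) `<=` rnball a r by apply: rnball_sub; move: xa;
  rewrite /rnball /=; lra.
by apply: (iterD_bound v k r2 (holE_sub sub H)) => y /sub; exact: hM.
Qed.

(** On this radius [taylor_const] times |v| / (r / 2) is at most 1/2, so remainders decay like 2^-N;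
    the added 1 also gives |v| < r / 2. *)
Lemma taylor_cvg E h (a v : V) (r M : R) : 0 < r -> holE E (rnball a r) h ->
  (forall x, rnball a r x -> rn (h x) <= M) -> rn v < r / (4 * (taylor_const + 1)) ->
  taylor_sum h a v N 1 @[N --> \oo] --> h (a + v).
Proof.
move=> r0 H hM vr; have K0 := @taylor_const_gt0 R.
have M0 : 0 <= M by apply: le_trans (rn_ge0 (h a)) (hM _ _); exact: rnball_center.
have v0 := rn_ge0 v.
have vr' : rn v * (4 * (taylor_const + 1)) < r by rewrite -ltr_pdivlMr //; nra.
have v2 : rn v < r / 2 by nra.
have inB (t : R) : 0 <= t <= 1 -> rnball a (r / 2) (a + t%:C *: v).
  move=> /andP[t0 t1]; rewrite /rnball /= addrAC subrr add0r rnZ rn_real ger0_norm //.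
  by apply: le_lt_trans v2; rewrite ler_piMl.
have sub x : rnball a (r / 2) x -> rnball a r x by rewrite /rnball /=; lra.
apply/cvg_seqP => e e0; have [N0 hN0] := expr_half_small M e0.
exists N0 => N /hN0; apply: le_trans.
have := taylor_remainder (open_rnball a r) H (fun t ht => sub _ (inB t ht))
  (fun t ht => iterD_ball v N r0 H hM (inB t ht)).
move=> /(_ 1); rewrite ler01 lexx => /(_ isT).
rewrite rmorph1 scale1r expr1n rnB => h1; apply: le_trans h1 _.
rewrite (mulrA (1 / N`!%:R)); apply: ler_wpM2r => //; rewrite mul1r (mulrC (N`!%:R^-1)).
have x0 : 0 <= rn v / (r / 2) by rewrite divr_ge0 //; lra.
apply: le_trans (taylor_const_fact N x0) _.
apply: lerXn2r; rewrite ?nnegrE; [by rewrite mulr_ge0 // ltW|lra|].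
rewrite mulrA ler_pdivrMr; last lra.
nra.
Qed.

(** Weierstrass test, with bounds that are local and start at some rank: the peaking functions used
    later are small only on the growing sets of an exhaustion. *)
Lemma holE_series E U (fs : nat -> V -> C) : open U -> (forall k, holE E U (fs k)) ->
  (forall a, U a -> exists2 r : R, 0 < r & exists N M, forall k x, (N <= k)%N ->
     rnball a r x -> rn (fs k x) <= (1 / 2) ^+ k * M) ->
  exists2 g, holE E U g & forall x, U x -> \sum_(k < n) fs k x @[n --> \oo] --> g x.
Proof.
move=> oU hfs bnd.
have tail x N M m p : (forall k, (N <= k)%N -> rn (fs k x) <= (1 / 2) ^+ k * M) ->
    (N <= m)%N -> (m <= p)%N -> 
    rn (\sum_(k < p) fs k x - \sum_(k < m) fs k x) <= 2 * (1 / 2) ^+ m * M.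
  move=> hb Nm mp.
  have M0 : 0 <= M.
    have := le_trans (rn_ge0 _) (hb N (leqnn _)).
    by rewrite pmulr_rge0 // exprn_gt0 //; lra.
  rewrite -(subnKC mp); elim: (p - m)%N => [|d IH].
    rewrite addn0 subrr rn0; have : 0 <= (1 / 2 : R) ^+ m * M.
      by apply: mulr_ge0 => //; apply: exprn_ge0; lra.
    lra.
  (* The subtracted power makes the bound inductive. *)
  have {}IH : rn (\sum_(k < m + d) fs k x - \sum_(k < m) fs k x) <=
     2 * ((1 / 2) ^+ m - (1 / 2) ^+ (m + d)) * M.
    elim: d {IH} => [|d IH]; first by rewrite addn0 !subrr rn0 mulr0 mul0r.
    rewrite addnS big_ord_recr /= addrAC; apply: le_trans (rnD _ _) _.
    have := hb (m + d)%N (leq_trans Nm (leq_addr _ _)).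
    rewrite exprSr; lra.
  rewrite addnS big_ord_recr /= addrAC; apply: le_trans (rnD _ _) _.
  have := hb (m + d)%N (leq_trans Nm (leq_addr _ _)).
  have : 0 <= (1 / 2 : R) ^+ (m + d) * M by rewrite mulr_ge0 // exprn_ge0 //; lra.
  lra.
have lim x : exists l : C, U x -> \sum_(k < n) fs k x @[n --> \oo] --> l.
  have [Ux|] := pselect (U x); last by exists 0.
  have [r r0 [N [M hN]]] := bnd x Ux.
  have hx k : (N <= k)%N -> rn (fs k x) <= (1 / 2) ^+ k * M.
    by move=> Nk; apply: hN => //; exact: rnball_center.
  have [|l hl] := @complex_complete _ (fun n => \sum_(k < n) fs k x); last by exists l.
  move=> e e0; have [N' hN'] := expr_half_small (2 * M) e0.
  exists (maxn N N') => m p; rewrite !geq_max => /andP[m1 m2] /andP[p1 p2].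
  wlog mp : m p m1 m2 p1 p2 / (p <= m)%N.
    move=> W; have [mp|/ltnW mp] := leqP p m; first exact: W.
    by rewrite rnB; exact: W.
  apply: le_trans (tail x N M p m hx p1 mp) _.
  by have := hN' p p2; lra.
have [g hg] := choice lim; exists g => //.
apply: (holE_limit (hs := fun n x => \sum_(k < n) fs k x)) => a Ua.
have [r1 r10 [N [M hN]]] := bnd a Ua.
have [r2 r20 hr2] := open_rnP oU Ua.
exists (Num.min r1 r2); first by rewrite lt_min r10.
have sub x : rnball a (Num.min r1 r2) x -> rnball a r1 x /\ U x.
  by rewrite /rnball /= lt_min => /andP[h1 /hr2].
exists 0%N.
  move=> m _; apply: (holE_sub (U := U)); first by move=> x /sub[].
  by apply: holE_sum => k _; exact: hfs.
move=> e e0; have [N' hN'] := expr_half_small (2 * M) e0.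
exists (maxn N N') => m; rewrite geq_max => /andP[m1 m2] x /sub[xa Ux].
have c : \sum_(k < m) fs k x - \sum_(k < n) fs k x @[n --> \oo] --> \sum_(k < m) fs k x
  - g x.
  by apply: cvgB; [exact: cvg_cst|exact: hg].
apply: (lim_rn_le (N := m) c) => p mp; rewrite rnB.
apply: le_trans (tail x N M m p (fun k Nk => hN k x Nk xa) m1 mp) _.
by have := hN' m m2; lra.
Qed.

(* The k-th homogeneous term at v is the limit of the rescaled Taylor remainders
   t ^- k (h (a + t v) - terms of degree < k) as t tends to 0. *)
Lemma holE_homogeneous E h (a : V) (r M : R) k : 0 < r -> holE E (rnball a r) h ->
  (forall x, rnball a r x -> rn (h x) <= M) -> holE E setT (fun v => iterD v k h a).
Proof.
(* Strong induction, because the remainder subtracts all terms of lower degree. *)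
move=> r0 H hM; have [n] := ubnP k; elim: n k => // n IH k; rewrite ltnS => kn.
have M0 : 0 <= M by apply: le_trans (rn_ge0 (h a)) (hM _ _); exact: rnball_center.
pose t m : R := (m.+1%:R)^-1.
have t0 m : 0 < t m by rewrite invr_gt0.
pose hs m v : C := k`!%:R * ((t m)%:C ^+ k)^-1 *
   (h (a + (t m)%:C *: v) - taylor_sum h a v k (t m)%:C).
apply: (holE_limit (hs := hs)) => v0 _; exists 1 => //.
pose b := rn v0 + 1; have b0 : 0 < b by rewrite /b; have := rn_ge0 v0; lra.
have vb v : rnball v0 1 v -> rn v < b.
  by rewrite /rnball /= => h1; have := rnD (v - v0) v0; rewrite subrK /b; lra.
have [N hN] := small_inv (divr_gt0 r0 (mulr_gt0 (ltr0n _ 2 : 0 < 2%:R) b0)).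
have inB m v (s : R) : (N <= m)%N -> rnball v0 1 v -> 0 <= s <= t m ->
  rnball a (r / 2) (a + s%:C *: v).
  move=> /hN mN /vb vb1 /andP[s0 s1]; rewrite /rnball /= addrAC subrr add0r rnZ rn_real
    ger0_norm //.
  move: mN; rewrite ltr_pdivlMr ?mulr_gt0 // -/(t m) => mN.
  have := rn_ge0 v; have := t0 m; nra.
have sub x : rnball a (r / 2) x -> rnball a r x by rewrite /rnball /=; lra.
exists N.
  move=> m mN; apply: holEZ; apply: holEB.
    apply: (holE_sub _ (@holE_affine _ _ E _ h a (t m)%:C H)) => v v1 /=.
    by apply: sub; apply: inB mN v1 _; rewrite ltW //=.
  apply: (holE_sum (hs := fun j v => (t m)%:C ^+ j / j`!%:R * iterD v j h a)) => j jk.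
  by apply: holEZ; apply: (holE_sub (U := setT)) => //; apply: IH;
    exact: leq_trans jk kn.
move=> e e0.
set B := (100 * k.+1%:R * (b / (r / 2))) ^+ k.+1 * M.
have B0 : 0 <= B.
  apply: mulr_ge0 => //; apply: exprn_ge0; apply: mulr_ge0; last first.
    by apply: divr_ge0; lra.
  by apply: mulr_ge0; exact: ler0n.
have B1 : 0 < B + 1 by lra.
have [N' hN'] := small_inv (divr_gt0 e0 B1).
exists (maxn N N') => m; rewrite geq_max => /andP[mN /hN' mN'] v v1.
have tC : (t m)%:C != 0 :> C.
  by apply: contra_neq (lt0r_neq0 (t0 m)) => /complexI.
have fk : k`!%:R != 0 :> C by rewrite pnatr_eq0 -lt0n fact_gt0.
have fkR : 0 < k`!%:R :> R by rewrite ltr0n fact_gt0.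
(* The error is a rescaled remainder of order k + 1, hence at most t B / (k + 1). *)
have -> : hs m v - iterD v k h a = k`!%:R * ((t m)%:C ^+ k)^-1 *
    (h (a + (t m)%:C *: v) - taylor_sum h a v k.+1 (t m)%:C).
  rewrite /hs /taylor_sum big_ord_recr /=.
  move: (\sum_(i < k) _) (h _) (iterD v k h a) => X Y Z.
  field; rewrite ?expf_neq0 ?fk ?tC //.
have bd s : 0 <= s <= t m -> rn (iterD v k.+1 h (a + s%:C *: v)) <= B.
  move=> sm; apply: le_trans (iterD_ball v k.+1 r0 H hM (inB m v s mN v1 sm)) _.
  apply: ler_wpM2r => //.
  have [b1 b2] : 0 <= 100 * k.+1%:R :> R /\ 0 <= (r / 2)^-1.
    by split; [apply: mulr_ge0; exact: ler0n|rewrite invr_ge0; lra].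
  apply: lerXn2r; rewrite ?nnegrE.
  - by rewrite !mulr_ge0 // rn_ge0.
  - by rewrite !mulr_ge0 // ltW.
  - by apply: ler_wpM2l => //; apply: ler_wpM2r => //; exact/ltW/vb.
have tt : 0 <= t m <= t m by rewrite lexx ltW.
have := taylor_remainder (open_rnball a r) H
  (fun s sm => sub _ (inB m v s mN v1 sm)) bd tt.
move=> hh; rewrite !rnM rn_nat rnV rnX rn_real (gtr0_norm (t0 m)).
have tk : 0 < t m ^+ k by exact: exprn_gt0.
apply: le_trans (ler_wpM2l _ hh) _.
  by apply: mulr_ge0; [exact: ltW|rewrite invr_ge0; exact: ltW].
have -> : k`!%:R * (t m ^+ k)^-1 * (t m ^+ k.+1 / (k.+1)`!%:R * B) = t m * B / k.+1%:R.
  rewrite factS natrM exprSr; field.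
  by rewrite !lt0r_neq0 // ltr0n.
rewrite ler_pdivrMr ?ltr0n //.
move: mN'; rewrite -/(t m) ltr_pdivlMr // => h2.
have k1 : 1 <= k.+1%:R :> R by rewrite ler1n.
have tm := t0 m; apply: (le_trans (_ : _ <= e)); last by rewrite ler_peMr // ltW.
nra.
Qed.

(** The estimates at the single point a fix the radius of convergence through d, however small the
    ball on which h is given; r only matters for the agreement near a. *)
Lemma holE_extension E h (a : V) (r M d M' : R) : 0 < r -> holE E (rnball a r) h ->
  (forall x, rnball a r x -> rn (h x) <= M) -> 0 < d ->
  (forall k v, rn (iterD v k h a) <= (100 * k%:R * (rn v / d)) ^+ k * M') ->
  exists2 g, holE E (rnball a (d / (2 * taylor_const))) g &
    exists2 e : R, 0 < e & forall x, rnball a e x -> g x = h x.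
Proof.
move=> r0 H hM d0 hk.
have K0 := @taylor_const_gt0 R.
have M0 : 0 <= M'.
  by have := le_trans (rn_ge0 _) (hk 0%N 0); rewrite expr0 mul1r.
pose fs k x : C := k`!%:R^-1 * iterD (x - a) k h a.
have hfs k : holE E (rnball a (d / (2 * taylor_const))) (fs k).
  apply: holEZ; apply: (holE_sub (U := setT)) => //.
  have := @holE_affine _ _ E _ _ (- a) 1 (holE_homogeneous k r0 H hM).
  by apply: eq_holE => x; rewrite scale1r addrC.
have bnd k x : rnball a (d / (2 * taylor_const)) x -> rn (fs k x) <= (1 / 2) ^+ k * M'.
  rewrite /rnball /= ltr_pdivlMr ?mulr_gt0 // => xa.
  have x0 : 0 <= rn (x - a) / d by rewrite divr_ge0 ?rn_ge0 // ltW.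
  rewrite /fs rnM rnV rn_nat.
  have fk : 0 <= k`!%:R^-1 :> R by rewrite invr_ge0 ler0n.
  apply: le_trans (ler_wpM2l fk (hk k (x - a))) _.
  rewrite (mulrA (k`!%:R^-1)); apply: ler_wpM2r => //; rewrite (mulrC (k`!%:R^-1)).
  apply: le_trans (taylor_const_fact k x0) _.
  apply: lerXn2r; rewrite ?nnegrE; [by rewrite mulr_ge0 // ltW|lra|].
  rewrite mulrA ler_pdivrMr //; lra.
have [g hg cg] : exists2 g, holE E (rnball a (d / (2 * taylor_const))) g &
    forall x, rnball a (d / (2 * taylor_const)) x ->
      \sum_(k < n) fs k x @[n --> \oo] --> g x.
  apply: holE_series => //; first exact: open_rnball.
  move=> x xa; have [r' r'0 hr'] := open_rnP (open_rnball a (d / (2 * taylor_const)))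
    xa.
  by exists r' => //; exists 0%N, M' => k y _ /hr'; exact: bnd.
(* Within the first radius the series sums to g, within the second to h. *)
exists g => //; exists (Num.min (d / (2 * taylor_const)) (r / (4 * (taylor_const +
  1)))).
  by rewrite lt_min !divr_gt0 // mulr_gt0 //; lra.
move=> x; rewrite /rnball /= lt_min => /andP[x1 x2].
have := taylor_cvg r0 H hM x2; rewrite (addrC a) subrK.
have -> : (fun N => taylor_sum h a (x - a) N 1) = (fun n => \sum_(k < n) fs k x).
  by apply/funext => n; apply: eq_bigr => k _; rewrite expr1n div1r.
by move=> c; apply: cvg_unique (cg x x1) c.
Qed.

Lemma iterD_zero h (a v : V) (e : R) k : (forall x, rnball a e x -> h x = 0) ->
  forall x, rnball a e x -> iterD v k h x = 0.
Proof.
move=> h0; elim: k => [|k IH] x xa; first exact: h0.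
rewrite iterDS -(@derive_cst _ V C 0 x v); apply: near_eq_derive.
have [r r0 hr] := open_rnP (open_rnball a e) xa.
by apply/nbhs_rnP; exists r => // y /hr; exact: IH.
Qed.

Lemma local_identity E h (a : V) (r M e : R) : 0 < r -> holE E (rnball a r) h ->
  (forall x, rnball a r x -> rn (h x) <= M) -> 0 < e -> (forall x,
    rnball a e x -> h x = 0) ->
  forall x, rnball a (r / (4 * (taylor_const + 1))) x -> h x = 0.
Proof.
move=> r0 H hM e0 h0 x xa.
have := taylor_cvg r0 H hM xa; rewrite (addrC a) subrK.
have -> : (fun N => taylor_sum h a (x - a) N 1) = fun=> 0.
  apply/funext => n; apply: big1 => k _.
  by rewrite (iterD_zero _ _ h0) ?mulr0 //; exact: rnball_center.
by move=> c; apply: cvg_unique c (cvg_cst _).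
Qed.

(** The set Z of points near which h vanishes is closed in A because the radius in [local_identity]
    depends on the ball where h is bounded, not on the size e of the initial zero set. *)
Lemma identity_theorem E (A : set V) h (a : V) (e : R) : open A -> connected A ->
  holE E A h -> A a -> 0 < e -> (forall x, rnball a e x -> h x = 0) ->
  forall x, A x -> h x = 0.
Proof.
move=> oA cA H Aa e0 h0.
pose Z := [set x | A x /\ exists2 e : R, 0 < e & forall y, rnball x e y -> h y = 0].
suff ZA : Z = A by move=> x; rewrite -ZA => -[_ [e' e'0]]; apply; exact: rnball_center.
have oZ : open Z.
  rewrite openE => x [Ax [e1 e10 h1]]; have [r r0 hr] := open_rnP oA Ax.
  apply/nbhs_rnP; exists (Num.min r (e1 / 2)); first by rewrite lt_min r0; lra.
  move=> y; rewrite lt_min => /andP[y1 y2]; split; first exact: hr.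
  exists (e1 / 2); first lra.
  by move=> z zy; apply: h1; apply: (@rnball_sub _ _ x y e1 (e1 / 2)) zy; lra.
apply: cA.
- by exists a; split=> //; exists e.
- by exists Z => //; apply/seteqP; split=> [x [Ax Zx]|x [_ //]]; split.
exists (closure Z); first exact: closed_closure.
apply/seteqP; split=> [x Zx|x [Ax cx]]; first by split;
  [case: Zx|exact: subset_closure].
have K0 := @taylor_const_gt0 R.
have [r1 r10 hr1] := open_rnP oA Ax.
have [r2 r20 hr2] := locally_bounded (differentiable_continuous (H x Ax).1).
pose r := Num.min r1 r2.
have r0 : 0 < r by rewrite lt_min r10.
have rA y : rnball x r y -> A y /\ rn (h y) <= rn (h x) + 1.
  by rewrite /rnball /= lt_min => /andP[/hr1 y1 /hr2].
(* The radius of [local_identity] for balls of radius r / 2 around points close to x: a point y of Z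
   within d of x forces h to vanish near x. *)
pose d := (r / 2) / (4 * (taylor_const + 1)).
have d0 : 0 < d by rewrite !divr_gt0 // mulr_gt0 //; lra.
have dr : d < r / 2.
  by rewrite /d ltr_pdivrMr; nra.
have [y [[Ay [e1 e10 h1]] yx]] := cx _ (nbhs_rnball x d0).
have sub : rnball y (r / 2) `<=` rnball x r.
  by apply: rnball_sub; move: yx; rewrite /rnball /=; lra.
have r2' : 0 < r / 2 by lra.
have hy := @local_identity E h y (r / 2) (rn (h x) + 1) e1 r2'
  (holE_sub (fun z zy => (rA z (sub z zy)).1) H) (fun z zy =>
    (rA z (sub z zy)).2) e10 h1.
split=> //; exists (d - rn (y - x)); first by move: yx; rewrite /rnball /=; lra.
move=> z zx; apply: hy; apply: (rnball_sub _ zx); rewrite rnB -/d; lra.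
Qed.

End Series.

(** * Compactness and connectedness *)

Section Topology.
Context {R : realType}.
Local Notation C := (R[i]).

Lemma rn_rV_le n (x : 'rV[C]_n) (e : R) : 0 <= e ->
  (rn x <= e <-> forall i, rn (x 0 i) <= e).
Proof.
move=> e0; have e0' : 0 <= e%:C :> C by rewrite ler0c.
rewrite -lecR -normE.
have -> : e%:C = (NngNum e0')%:num :> C by [].
rewrite -[`|x|]/(mx_norm x) mx_normE num_le; split.
  by move=> /bigmax_leP[_ H] i; rewrite -lecR -normE; exact: (H (0, i)).
move=> H; apply/bigmax_leP; split; first by rewrite -num_le.
by case=> i j _; rewrite -num_le /= normE lecR ord1; exact: H.
Qed.

Lemma rn_coord_le n (x : 'rV[C]_n) i : rn (x 0 i) <= rn x.
Proof. by have /(_ (lexx _)) := (rn_rV_le x (rn_ge0 x)).1; apply. Qed.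

(** Common source of the compactness arguments below: bounds, a distance to the complement,
    closedness of thickenings. *)
Lemma compact_uniform (V : normedModType C) (K : set V) (P : R -> V -> Prop) :
  compact K ->
  (forall x, K x -> exists2 e : R, 0 < e & forall y s,
    rn (y - x) < e -> 0 < s < e -> P s y) ->
  exists2 e : R, 0 < e & forall s, 0 < s < e -> forall x, K x -> P s x.
Proof.
move=> /compact_near_coveringP cK H.
have [|e /= e0 he] := cK R (0^'+) P _ _.
- move=> x /H[e e0 he].
  exists (rnball x e, [set s : R | 0 < s < e]) => /=; last first.
    by move=> [y s] /= [h1 h2]; exact: he.
  split; first exact: nbhs_rnball.
  near=> s; rewrite /=; apply/andP; split; near: s.
    exact: nbhs_right_gt.
  exact: nbhs_right_lt.
exists e => // s /andP[s0 se]; apply: (he s) => //=.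
by rewrite sub0r normrN gtr0_norm.
Unshelve. all: by end_near. Qed.

Lemma compact_rn_bounded (V W : normedModType C) (K : set V) (h : V -> W) :
  compact K -> (forall x, K x -> {for x, continuous h}) ->
  exists M : R, forall x, K x -> rn (h x) <= M.
Proof.
move=> cK ch.
(* Bounds are written s^-1, so that small s means a large bound. *)
have [x Kx|e e0 he] := @compact_uniform _ K (fun s x => rn (h x) <= s^-1) cK.
  have /continuous_rnP/(_ _ ltr01)[r r0 hr] := ch x Kx.
  have h0 := rn_ge0 (h x).
  exists (Num.min r (rn (h x) + 1)^-1).
    by rewrite lt_min r0 invr_gt0; lra.
  move=> y s; rewrite !lt_min => /andP[yx _] /andP[s0 /andP[_ s2]].
  have h1 : rn (h y) < rn (h x) + 1.
    have := rnD (h y - h x) (h x); rewrite subrK; have := hr y yx; lra.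
  apply: le_trans (ltW h1) _; rewrite -[_ + 1]invrK lef_pV2 ?posrE //; last first.
    by rewrite invr_gt0; lra.
  exact: ltW.
exists (e / 2)^-1 => x Kx; apply: he => //; lra.
Qed.

Lemma compact_in_open (V : normedModType C) (K U : set V) : compact K -> open U ->
  K `<=` U -> exists2 r : R, 0 < r & forall x, K x -> rnball x r `<=` U.
Proof.
move=> cK oU KU.
have [x Kx|e e0 he] := @compact_uniform _ K (fun s x => rnball x s `<=` U) cK.
  have [r r0 hr] := open_rnP oU (KU x Kx); exists (r / 2); first lra.
  move=> y s yx /andP[_ sr]; apply: subset_trans hr; apply: rnball_sub; lra.
by exists (e / 2) => [|x Kx]; [lra|apply: he => //; lra].
Qed.

Definition thicken (V : normedModType C) (K : set V) (r : R) :=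
  [set y | exists2 x, K x & rn (y - x) <= r].

Lemma closed_rnP (V : normedModType C) (A : set V) :
  (forall x, ~ A x -> exists2 e : R, 0 < e & forall y, rn (y - x) < e -> ~ A y) ->
  closed A.
Proof.
move=> H; rewrite -[A]setCK; apply: open_closedC; rewrite openE => x /H[e e0 he].
by apply/nbhs_rnP; exists e.
Qed.

Lemma closed_thicken (V : normedModType C) (K : set V) (r : R) : compact K ->
  closed (thicken K r).
Proof.
move=> cK; apply: closed_rnP => x nx.
have [y Ky|e e0 he] := @compact_uniform _ K (fun s y => r + s < rn (x - y)) cK.
  have xy : r < rn (x - y) by rewrite ltNge; apply/negP => h; apply: nx; exists y.
  exists ((rn (x - y) - r) / 2); first lra.
  move=> z s zy /andP[s0 s1]; have := rn_tri x z y; lra.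
exists (e / 2); first lra.
move=> y yx [z Kz yz]; have := he (e / 2) _ z Kz.
have -> : 0 < e / 2 < e by lra.
move=> /(_ isT); have := rn_tri x y z; rewrite (rnB x y); lra.
Qed.

(** Heine-Borel: every coordinate lies in the continuous image of a compact real square. *)
Lemma compact_rV n (A : set 'rV[C]_n) (M : R) : closed A ->
  (forall x, A x -> rn x <= M) -> compact A.
Proof.
move=> cA hA.
pose box : set C := (fun v : 'rV[R]_2 => (v ord0 0) +i* (v ord0 1)) @` [set v :
  'rV[R]_2 | forall i, `[- M, M]%classic (v ord0 i)].
have cbox : compact box.
  apply: continuous_compact; last first.
    by apply: (rV_compact (A := fun=> `[- M, M]%classic)) => i; exact: segment_compact.
  apply: continuous_subspaceT => v; apply/(@cvg_rnP _ _ (nbhs v)) => e e0.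
  have e2 : 0 < e / 2 by lra.
  have h i : nbhs v [set w : 'rV[R]_2 | `|w ord0 i - (v : 'rV[R]_2) ord0 i| < e / 2].
    have /cvgrPdist_lt/(_ _ e2) := @coord_continuous R 1 2 ord0 i v.
    by apply: filterS => w /=; rewrite distrC.
  apply: filterS (filterI (h 0) (h 1)) => w [/= h0 h1].
  apply: le_lt_trans (rn_complex_le (w ord0 0 - (v : 'rV[R]_2) ord0 0) (w ord0 1 - (v :
    'rV[R]_2) ord0 1)) _.
  lra.
apply: (subclosed_compact cA (rV_compact (fun i : 'I_n => cbox))) => x /hA xM i /=.
have := le_trans (rn_coord_le x i) xM.
case: (x ord0 i) => a b ab; exists (\row_j if j == 0 then a else b).
  move=> j /=; rewrite in_itv /= -ler_norml mxE; apply: le_trans ab.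
  by case: ifP => _; [exact: (Re_le_rn (a +i* b))|exact: (Im_le_rn (a +i* b))].
by rewrite !mxE.
Qed.

Lemma compact_thicken n (K : set 'rV[C]_n) (r : R) : compact K -> compact (thicken K r).
Proof.
move=> cK.
have [M hM] := @compact_rn_bounded _ _ K id cK (fun x _ => cvg_id).
apply: (@compact_rV _ _ (M + r)); first exact: closed_thicken.
move=> y [x Kx yx]; have := rnD (y - x) x; rewrite subrK; have := hM x Kx; lra.
Qed.

Lemma connected_rnball (V : normedModType C) (a : V) (r : R) : 0 < r ->
  connected (rnball a r).
Proof.
move=> r0.
have -> : rnball a r = \bigcup_(x in rnball a r) ((fun t : R =>
  a + t%:C *: (x - a)) @` `[0, 1]).
  apply/seteqP; split=> [x xa|x [y ya [t /= t01 <-]]].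
    exists x => //; exists 1; first by rewrite /= in_itv /= ler01 lexx.
    by rewrite rmorph1 scale1r addrC subrK.
  by apply: rnball_convex; [exact: rnball_center|exact: ya|move: t01; rewrite in_itv].
apply: bigcup_connected.
  exists a => x _; exists 0; first by rewrite /= in_itv /= lexx ler01.
  by rewrite rmorph0 scale0r addr0.
move=> x _; apply: connected_continuous_connected; first exact: segment_connected.
apply: continuous_subspaceT => t; apply/(@cvg_rnP _ _ (nbhs t)) => e e0.
have x1 : 0 < rn (x - a) + 1 by have := rn_ge0 (x - a); lra.
apply/nbhs_normP; exists (e / (rn (x - a) + 1)) => /=; first exact: divr_gt0.
move=> s /=; rewrite ltr_pdivlMr // => st.
have -> : a + s%:C *: (x - a) - (a + t%:C *: (x - a)) = (s - t)%:C *: (x - a).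
  by rewrite opprD addrACA subrr add0r -scalerBl rmorphB.
rewrite rnZ rn_real distrC; apply: le_lt_trans st.
by apply: ler_wpM2l => //; lra.
Qed.

End Topology.

(** * The hull of a compact set *)

Section Blocks.
Context {R : realType} {n : nat} {l : 'I_n -> nat}.
Local Notation C := (R[i]).
Local Notation X := (@blockspace R n l).
Implicit Types (U K : set X) (f : X -> @Cspace R n) (h : X -> C).

Definition other_block (i : 'I_n) : set X :=
  [set e | exists2 j : 'I_n, i != j & exists k : 'I_(l j),
    e = delta_mx 0 (@tagnat.Rank n l j k)].

Lemma Cn_holomorphicP U f : Cn_holomorphic U f <->
  forall i, holE (other_block i) U (fun z => f z 0 i).
Proof.
split=> [[df pf] i x Ux|H].
  have dc : differentiable (fun w : @Cspace R n =>
    w 0 i) (f x) by exact: differentiable_coord.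
  split=> [|e [j ij [k ->]]]; first exact: (differentiable_comp (df x Ux) dc).
  exact: pf.
split=> [x Ux|x Ux i j ij k]; last by have [_] := H i x Ux; apply; exists j => //;
  exists k.
have -> : f = \sum_(i < n) (fun z => f z 0 i *: delta_mx 0 i).
  apply/funext => z; rewrite fct_sumE; exact: row_sum_delta.
apply: differentiable_sum => i; apply: differentiableZl.
by have [] := H i x Ux.
Qed.

Lemma holE_continuous (V : normedModType C) (E : set V) (A : set V) (h : V -> C) x :
  holE E A h -> A x -> {for x, continuous h}.
Proof. by move=> H Ax; apply: differentiable_continuous; have [] := H x Ax. Qed.

(** Placing h in the i-th component and 0 in the others gives a C^n-holomorphic map whose maximum
    norm is |h|. *)
Lemma hull_scalar U K i h a (B : R) : holE (other_block i) U h -> 0 <= B ->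
  (forall w, K w -> rn (h w) <= B) -> Cn_hull U K a -> rn (h a) <= B.
Proof.
move=> H B0 hB [Ua hull].
pose f z : @Cspace R n := \row_j (if j == i then h z else 0).
have fH : Cn_holomorphic U f.
  apply/Cn_holomorphicP => j; rewrite /f.
  have [->|ji] := eqVneq j i.
    by apply: eq_holE H => z; rewrite mxE eqxx.
  by apply: (eq_holE _ (@holE_cst _ _ (other_block j) U 0)) => z;
    rewrite mxE (negbTE ji).
have fa : rn (h a) <= rn (f a) by have := rn_coord_le (f a) i; rewrite mxE eqxx.
apply: le_trans fa _; apply: le_trans (hull f fH) _.
(* For empty K the supremum is 0 by convention, which 0 <= B covers. *)
have [[w Kw]|/set0P/negP/negPn/eqP ->] := pselect (K !=set0);
  last by rewrite image_set0 sup0.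
apply: ge_sup; first by exists (rn (f w)), w.
move=> _ [z Kz <-]; apply/(rn_rV_le (f z) B0) => j; rewrite mxE.
by case: ifP => _; [exact: hB|rewrite rn0].
Qed.

(** These functions bound the hull coordinate by coordinate. *)
Lemma holE_coord U (i : 'I_n) (k : 'I_(l i)) :
  holE (other_block i) U (fun z : X => z 0 (@tagnat.Rank n l i k)).
Proof.
move=> x _; set m := tagnat.Rank i k.
split=> [|e [j ij [k' ->]]]; first exact: differentiable_coord.
have H : is_derive x (delta_mx 0 (@tagnat.Rank n l j k') : X) (fun z : X => z 0 m) 0.
  apply/is_derive_rnP => eps eps0; exists 1 => // t _.
  rewrite !mxE eqxx /= scaler0 subr0.
  have -> : (m == tagnat.Rank j k') = false.
    apply/negbTE; apply: contra_neq ij => mE.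
    by rewrite -(tagnat.Rank1K k) -/m mE tagnat.Rank1K.
  by rewrite mulr0 addr0 subrr rn0 mulr_ge0 ?rn_ge0 // ltW.
exact: derive_val.
Qed.

Lemma hull_sub U K : Cn_hull U K `<=` U.
Proof. by move=> x []. Qed.

Lemma hull_bounded U K : compact K -> exists M : R, forall x,
  Cn_hull U K x -> rn x <= M.
Proof.
move=> cK; have [M hM] := @compact_rn_bounded _ _ _ K id cK (fun x _ => cvg_id).
exists `|M| => x hx; apply/(rn_rV_le _ (normr_ge0 M)) => m.
rewrite -(tagnat.sig2K m).
apply: (hull_scalar (@holE_coord U _ (tagnat.sig2 m)) (normr_ge0 M)) hx => w Kw.
by apply: le_trans (rn_coord_le _ _) _; apply: le_trans (hM w Kw) (ler_norm M).
Qed.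

(** The iterated derivatives of a component stay in its class, so their bounds on K hold at a. The
    component then extends to a ball whose radius ignores the distance from a to the complement;
    were this ball not inside U, it would be a forbidden V. *)
Lemma hull_extension U K a (r : R) : open U -> domain_of_Cn_holomorphy U ->
  compact K -> K `<=` U -> 0 < r -> (forall x, K x -> rnball x r `<=` U) ->
  Cn_hull U K a -> rnball a (r / 2 / (2 * taylor_const)) `<=` U.
Proof.
move=> oU [_ domU] cK KU r0 hr ha.
have K0 := @taylor_const_gt0 R.
have r2 : 0 < r / 2 by lra.
pose rho := r / 2 / (2 * taylor_const).
have rho0 : 0 < rho by rewrite /rho divr_gt0 // mulr_gt0.
apply: contrapT => nsub.
have VU : rnball a rho `\` U !=set0.
  apply: contrapT => h; apply: nsub => x xa; apply: contrapT => nx.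
  by apply: h; exists x.
have Ua : U a by exact: hull_sub ha.
have [s0 s00 hs0] := open_rnP oU Ua.
pose s := Num.min s0 rho.
have s1 : 0 < s by rewrite lt_min s00.
have sU x : rnball a s x -> U x /\ rnball a rho x.
  by rewrite /rnball /= lt_min => /andP[/hs0].
have [f /Cn_holomorphicP fH fext] := domU (rnball a rho) (rnball a s) (open_rnball a
  rho)
  (open_rnball a s) (connected_rnball (a := a) rho0) VU (ex_intro _ a (rnball_center a
    s1)) sU.
suff H i : exists g : X -> C, holE (other_block i) (rnball a rho) g /\
    forall x, rnball a s x -> f x 0 i = g x.
  have [g hg] := choice H.
  apply: (fext (fun z => \row_i g i z)).
    apply/Cn_holomorphicP => i; have [gH _] := hg i.
    by apply: eq_holE gH => z; rewrite mxE.
  by move=> z zs; apply/rowP => i; rewrite mxE; have [_ ->] := hg i.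
have hH := fH i; set h := (fun z => f z 0 i) in hH.
have KtU x : thicken K (r / 2) x -> U x.
  by move=> [y Ky xy]; apply: (hr y Ky); rewrite /rnball /=; lra.
(* Half of r is given up to have h bounded on a compact neighbourhood of K. *)
have [M hM] := compact_rn_bounded (compact_thicken (r := r / 2) cK)
  (fun x hx => holE_continuous hH (KtU x hx)).
have hk k v : rn (iterD v k h a) <= (100 * k%:R * (rn v / (r / 2))) ^+ k * `|M|.
  have B0 : 0 <= (100 * k%:R * (rn v / (r / 2))) ^+ k * `|M|.
    apply: mulr_ge0 => //; apply: exprn_ge0; apply: mulr_ge0.
      by apply: mulr_ge0; exact: ler0n.
    by apply: divr_ge0; [exact: rn_ge0|lra].
  apply: (hull_scalar (holE_iterD v k oU hH) B0) ha => w Kw.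
  have sub : rnball w (r / 2) `<=` thicken K (r / 2).
    by move=> y yw; exists w => //; exact: ltW.
  apply: (iterD_bound v k r2 (holE_sub (fun y yw => KtU y (sub y yw)) hH)) =>
    y /sub/hM hy.
  exact: le_trans hy (ler_norm M).
have [t t0 ht] := locally_bounded (holE_continuous hH Ua).
pose q := Num.min s t.
have q0 : 0 < q by rewrite lt_min s1.
have qs x : rnball a q x -> rnball a s x /\ rnball a t x by rewrite /rnball /= lt_min
  => /andP.
have hq : holE (other_block i) (rnball a q) h.
  by apply: holE_sub hH => x /qs[/sU[]].
have [g gH [e e0 ge]] := holE_extension q0 hq (fun x xq => ht x (qs x xq).2) r2 hk.
(* So far g equals h only near a; the identity theorem spreads this over the ball of radius s. *)
exists g; split=> // x xs; apply/eqP; rewrite -subr_eq0; apply/eqP.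
have dH : holE (other_block i) (rnball a s) (fun x => f x 0 i - g x).
  apply: holEB; first by apply: holE_sub hH => y /sU[].
  by apply: holE_sub gH => y /sU[].
apply: (identity_theorem (open_rnball a s) (connected_rnball (a :=
  a) s1) dH (rnball_center a s1) e0 _ xs).
by move=> y /ge ->; rewrite subrr.
Qed.

(** The hull is bounded. A limit x of hull points is within rho of one of them, hence in U, where
    the defining inequalities pass to x by continuity. *)
Lemma holomorphy_convex U : open U -> domain_of_Cn_holomorphy U ->
  Cn_holomorphically_convex U.
Proof.
move=> oU dU K cK KU.
have [r r0 hr] := compact_in_open cK oU KU.
have K0 := @taylor_const_gt0 R.
pose rho := r / 2 / (2 * taylor_const).
have rho0 : 0 < rho by rewrite /rho !divr_gt0 // mulr_gt0.
have hext a : Cn_hull U K a -> rnball a rho `<=` U.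
  by move=> ha; exact: (hull_extension oU dU cK KU r0 hr ha).
have [M hM] := hull_bounded U cK.
apply: (compact_rV _ hM) => x cx.
have Ux : U x.
  have [a [ha xa]] := cx _ (nbhs_rnball x rho0).
  by apply: (hext a ha); move: xa; rewrite /rnball /= rnB.
split=> // f fH; rewrite leNgt; apply/negP => lt.
have cf : {for x, continuous f} by apply: differentiable_continuous; exact: fH.1.
have d0 : 0 < rnorm (f x) - sup [set rnorm (f w) | w in K] by rewrite subr_gt0.
have /continuous_rnP/(_ _ d0)[d d1 hd] := cf.
have [a [[_ /(_ f fH) ha] xa]] := cx _ (nbhs_rnball x d1).
have := rnD (f x - f a) (f a); rewrite subrK (rnB (f x)).
have := hd a xa; rewrite /rnorm -/(rn (f x)) -/(rn (f a)) in ha lt *; lra.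
Qed.

Lemma existence_holomorphy U : domain_of_Cn_existence U -> domain_of_Cn_holomorphy U.
Proof.
move=> [oU [f fH hf]]; split=> // V W oV oW cV VU W0 WUV; exists f => //.
exact: hf V W oV oW cV VU W0 WUV.
Qed.

End Blocks.

(** * Construction of a function that cannot be continued *)

Section Powers.
Context {R : realType}.
Implicit Types (x e B : R).

Lemma bernoulli x q : 1 <= x -> 1 + q%:R * (x - 1) <= x ^+ q.
Proof.
move=> x1; elim: q => [|q IH]; first by rewrite mul0r addr0 expr0.
rewrite exprS -natr1.
have q0 : 0 <= q%:R :> R by exact: ler0n.
have : x * (1 + q%:R * (x - 1)) <= x * x ^+ q by rewrite ler_pM2l //; lra.
have : 0 <= q%:R * (x - 1) * (x - 1) by rewrite !mulr_ge0 //; lra.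
lra.
Qed.

Lemma pow_large x B : 1 < x -> exists N, forall q, (N <= q)%N -> B < x ^+ q.
Proof.
move=> x1; exists (Num.truncn (`|B| / (x - 1))).+1 => q Nq.
have x0 : 0 < x - 1 by lra.
have h : `|B| / (x - 1) < q%:R.
  by apply: lt_le_trans (truncnS_gt _) _; rewrite ler_nat.
rewrite ltr_pdivrMr // in h.
have := bernoulli q (ltW x1); have := ler_norm B; lra.
Qed.

Lemma pow_small x e : 0 <= x -> x < 1 -> 0 < e ->
  exists N, forall q, (N <= q)%N -> x ^+ q <= e.
Proof.
rewrite le_eqVlt => /predU1P[<- _ e0|x0 x1 e0].
  by exists 1%N => -[//|q] _; rewrite expr0n /= ltW.
have [|N hN] := @pow_large x^-1 e^-1; first by rewrite invf_gt1.
exists N => q /hN; rewrite exprVn ltf_pV2 ?posrE ?exprn_gt0 //; exact: ltW.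
Qed.

Lemma half_expn_le a b : (a <= b)%N -> (1 / 2 : R) ^+ b <= (1 / 2) ^+ a.
Proof. by move=> ab; apply: ler_wiXn2l => //; lra. Qed.

Lemma half_telescope d :
  1 - (1 / 2) ^+ d + (1 / 2) ^+ d.+1 <= 1 - (1 / 2) ^+ d.+1 :> R.
Proof. by rewrite exprS; lra. Qed.

Lemma half_expn_le1 d : 1 - (1 / 2) ^+ d <= 1 :> R.
Proof. by rewrite lerBlDr lerDl exprn_ge0 //; lra. Qed.

Lemma le_of_close (j a b c : R) : j + 1 < a -> a <= b + c -> b <= 1 -> j <= c.
Proof. by lra. Qed.

End Powers.

(** * Exhaustion by compact sets and inscribed balls *)

Section Exhaustion.
Context {R : realType} {N : nat}.
Local Notation C := (R[i]).
Local Notation X := ('rV[C]_N).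
Variable U : set X.
Hypothesis oU : open U.

Definition exhaustion (m : nat) : set X :=
  [set x | rn x <= m%:R /\ rnball x (m.+1%:R)^-1 `<=` U].

Lemma exhaustion_sub m : exhaustion m `<=` U.
Proof. by move=> x [_]; apply; apply: rnball_center; rewrite invr_gt0 ltr0n. Qed.

Lemma exhaustion_mono m p : (m <= p)%N -> exhaustion m `<=` exhaustion p.
Proof.
move=> mp x [h1 h2]; split; first by apply: le_trans h1 _; rewrite ler_nat.
apply: subset_trans h2; apply: rnball_sub; rewrite subrr rn0 add0r.
by rewrite lef_pV2 ?posrE ?ltr0n // ler_nat.
Qed.

Lemma exhaustion_compact m : compact (exhaustion m).
Proof.
apply: (@compact_rV _ _ _ m%:R); last by move=> x [].
apply: closed_rnP => x nx.
have [xm|xm] := leP (rn x) m%:R; last first.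
  exists (rn x - m%:R); first by rewrite subr_gt0.
  move=> y yx [ym _]; have := rnD (x - y) y; rewrite subrK (rnB x); lra.
have : ~ rnball x (m.+1%:R)^-1 `<=` U by move=> h; apply: nx.
move=> /existsNP[y /not_implyP[yx nUy]].
move: yx; rewrite /rnball /= => yx.
exists ((m.+1%:R)^-1 - rn (y - x)); first by rewrite subr_gt0.
move=> z zx [_ hz]; apply: nUy; apply: hz; rewrite /rnball /=.
have := rn_tri y x z; rewrite (rnB x z); move: zx.
move: (m.+1%:R^-1) (rn (y - x)) (rn (z - x)) (rn (y - z)) => *; lra.
Qed.

Lemma exhaustion_nbhs a : U a -> exists2 r : R, 0 < r & exists m,
  rnball a r `<=` exhaustion m.
Proof.
move=> Ua; have [r r0 hr] := open_rnP oU Ua.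
have r2 : 0 < r / 2 by lra.
have [n1 hn1] := small_inv r2.
pose m := maxn n1 (Num.truncn (rn a + 1)).+1.
exists (Num.min 1 (r / 2)); first by rewrite lt_min ltr01.
exists m => x; rewrite /rnball /= lt_min => /andP[x1 x2]; split.
  have h : rn a + 1 < m%:R.
    by apply: lt_le_trans (truncnS_gt _) _; rewrite ler_nat leq_maxr.
  have := rnD (x - a) a; rewrite subrK; lra.
apply: subset_trans hr; apply: rnball_sub.
move: (hn1 m (leq_maxl _ _)) x2; move: (m.+1%:R^-1) (rn (x - a)) => *; lra.
Qed.

(** Written as a union, the largest ball around a inside U has a meaning even when U is the whole
    space; it is empty for a outside U. *)
Definition inscribed_ball (a : X) : set X := \bigcup_(r in [set r | 0 < r /\ rnball a r
  `<=` U]) rnball a r.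

Lemma inscribed_ball_sub a : inscribed_ball a `<=` U.
Proof. by move=> x [r [_ hr] /hr]. Qed.

Lemma inscribed_ball_open a : open (inscribed_ball a).
Proof. by apply: bigcup_open => r _; exact: open_rnball. Qed.

Lemma inscribed_ball_center a : U a -> inscribed_ball a a.
Proof.
by move=> /(open_rnP oU)[r r0 hr]; exists r => //; exact: rnball_center.
Qed.

Lemma inscribed_ball_connected a : connected (inscribed_ball a).
Proof.
apply: bigcup_connected; first by exists a => r [r0 _]; exact: rnball_center.
by move=> r [r0 _]; exact: connected_rnball.
Qed.

Lemma inscribed_ball_dist a p : ~ U p -> inscribed_ball a `<=` rnball a (rn (p - a)).
Proof.
move=> np x [r [r0 hr] xa]; apply: lt_le_trans xa _.
by rewrite leNgt; apply/negP => /hr.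
Qed.

(** If L contained it, points of L would have e-balls inside U, so every radius r could be enlarged
    to r + e / 2; after finitely many steps the ball would reach p. *)
Lemma inscribed_ball_noncompact a p (L : set X) : U a -> ~ U p -> compact L ->
  L `<=` U ->
  ~ (inscribed_ball a `<=` L).
Proof.
move=> Ua np cL LU aL.
have [e e0 he] := compact_in_open cL oU LU.
have [r0 r00 hr0] := open_rnP oU Ua.
have step r : 0 < r -> rnball a r `<=` U -> rnball a (r + e / 2) `<=` U.
  move=> rp hr x; rewrite /rnball /= => xa.
  have re : 0 < r + e / 2 by lra.
  pose t := r / (r + e / 2).
  have t0 : 0 < t by exact: divr_gt0.
  have t1 : t * (r + e / 2) = r by rewrite /t divfK // lt0r_neq0.
  have tl1 : t < 1 by rewrite /t ltr_pdivrMr; lra.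
  have yL : L (a + t%:C *: (x - a)).
    apply: aL; exists r => //; rewrite /rnball /= addrAC subrr add0r rnZ rn_real
      gtr0_norm //.
    by rewrite -t1 ltr_pM2l.
  apply: (he _ yL); rewrite /rnball /=.
  have -> : x - (a + t%:C *: (x - a)) = (1 - t)%:C *: (x - a).
    by rewrite rmorphB /= scalerBl scale1r opprD addrA.
  rewrite rnZ rn_real gtr0_norm ?subr_gt0 //.
  have : (1 - t) * rn (x - a) < (1 - t) * (r + e / 2) by rewrite ltr_pM2l // subr_gt0.
  lra.
have iter k : rnball a (r0 + k%:R * (e / 2)) `<=` U.
  elim: k => [|k IH]; first by rewrite mul0r addr0.
  rewrite -natr1 mulrDl mul1r addrA; apply: step => //.
  by rewrite ltr_wpDr // mulr_ge0 ?ler0n //; lra.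
have e2 : 0 < e / 2 by lra.
apply: np; apply: (iter (Num.truncn (rn (p - a) / (e / 2))).+1); rewrite /rnball /=.
apply: ltr_wpDl => //; first exact: ltW.
by rewrite -ltr_pdivrMr //; exact: truncnS_gt.
Qed.

End Exhaustion.

(** * Density of the points with rational coordinates *)

Section Density.
Context {R : realType}.
Local Notation C := (R[i]).

(** Indexed by a countable type, so that [pickle] enumerates these points. *)
Definition ratpoint N (w : 'rV[(rat * rat)%type]_N) : 'rV[C]_N :=
  \row_j (ratr (w 0 j).1 +i* ratr (w 0 j).2).

Lemma ratpoint_dense N (x : 'rV[C]_N) (e : R) : 0 < e ->
  exists w, rn (ratpoint w - x) < e.
Proof.
move=> e0; have e4 : 0 < e / 4 by lra.
have apx (t : R) : exists q : rat, `|ratr q - t| <= e / 4.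
  have tt : t - e / 4 < t + e / 4 by lra.
  have [q] := rat_in_itvoo tt; rewrite in_itv /= => h; exists q.
  by rewrite ler_norml; lra.
have [q hq] := choice apx.
exists (\row_j (q (complex.Re (x 0 j)), q (complex.Im (x 0 j)))).
apply: (@le_lt_trans _ _ (e / 2)); last lra.
have e2 : 0 <= e / 2 by lra.
apply/(rn_rV_le _ e2) => j; rewrite !mxE /=.
apply: le_trans (rn_le_ReIm _) _; rewrite ReB ImB /=.
have := hq (complex.Re (x 0 j)); have := hq (complex.Im (x 0 j)); lra.
Qed.

End Density.

(** * Peaking functions and a function without continuation *)

Section Construction.
Context {R : realType} {n : nat} {l : 'I_n -> nat}.
Local Notation C := (R[i]).
Local Notation X := (@blockspace R n l).
Local Notation Y := (@Cspace R n).
Variable U : set X.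
Hypothesis oU : open U.

Lemma holEX (V : normedModType C) (E A : set V) (h : V -> C) q :
  holE E A h -> holE E A (fun z => h z ^+ q).
Proof.
move=> H; elim: q => [|q IH].
  by apply: (eq_holE _ (@holE_cst _ _ E A 1)) => z; rewrite expr0.
by apply: (eq_holE _ (holEM H IH)) => z; rewrite exprS.
Qed.

(** Some component of a separating map exceeds at z its supremum over K; divided by a number in
    between, its high powers are small on K and large at z, and powers stay in the class. *)
Lemma Cn_peak (K : set X) (z : X) (e B : R) : compact K -> K `<=` U -> U z ->
  ~ Cn_hull U K z -> 0 < e ->
  exists h : X -> Y, [/\ Cn_holomorphic U h, forall w,
    K w -> rn (h w) <= e & B < rn (h z)].
Proof.
move=> cK KU Uz nz e0.
have [f [fH fz]] : exists f, Cn_holomorphic U f /\ sup [set rnorm (f w) | w in K] < rn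
  (f z).
  apply: contrapT => H; apply: nz; split=> // f fH; rewrite leNgt; apply/negP => lt.
  by apply: H; exists f.
set s := sup _ in fz.
have [M hM] := compact_rn_bounded cK (fun x Kx =>
  differentiable_continuous (fH.1 x (KU x Kx))).
have Ks w : K w -> rn (f w) <= s.
  move=> Kw; apply: ub_le_sup; last by exists w.
  by exists M => _ [y Ky <-]; exact: hM.
have s0 : 0 <= s.
  have [[w Kw]|/set0P/negP/negPn/eqP K0] := pselect (K !=set0).
    exact: le_trans (rn_ge0 _) (Ks w Kw).
  by rewrite /s K0 image_set0 sup0.
have [i hi] : exists i, s < rn (f z 0 i).
  apply: contrapT => H; have : rn (f z) <= s.
    apply/(rn_rV_le _ s0) => i; rewrite leNgt; apply/negP => lt.
    by apply: H; exists i.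
  by rewrite leNgt fz.
pose c := (s + rn (f z 0 i)) / 2.
have c0 : 0 < c by rewrite /c; lra.
have sc : s / c < 1 by rewrite ltr_pdivrMr // /c; lra.
have sc0 : 0 <= s / c by rewrite divr_ge0 // ltW.
have tc : 1 < rn (f z 0 i) / c by rewrite ltr_pdivlMr // /c; lra.
have [N1 h1] := pow_small sc0 sc e0; have [N2 h2] := pow_large B tc.
pose q := maxn N1 N2.
pose u w : C := ((c^-1)%:C * f w 0 i) ^+ q.
have uE w : rn (u w) = (rn (f w 0 i) / c) ^+ q.
  by rewrite /u rnX rnM rn_real gtr0_norm ?invr_gt0 // mulrC.
exists (fun w => \row_j (if j == i then u w else 0)); split.
- apply/Cn_holomorphicP => j; have [->|ji] := eqVneq j i.
    apply: (@eq_holE _ _ _ _ u); first by move=> w; rewrite mxE eqxx.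
    apply: holEX; apply: holEZ; exact: (Cn_holomorphicP _ _).1 fH i.
  by apply: (eq_holE _ (@holE_cst _ _ (other_block j) U 0)) => w;
    rewrite mxE (negbTE ji).
- move=> w Kw; apply/(rn_rV_le _ (ltW e0)) => j; rewrite mxE.
  case: ifP => _; last by rewrite rn0 ltW.
  rewrite uE; apply: le_trans (h1 q (leq_maxl _ _)).
  apply: lerXn2r; rewrite ?nnegrE //; first by rewrite divr_ge0 ?rn_ge0 // ltW.
  rewrite ler_pM2r ?invr_gt0 //; apply: le_trans (rn_coord_le _ _) (Ks w Kw).
- set v := \row_j _; apply: lt_le_trans (rn_coord_le v i).
  by rewrite mxE eqxx uE; apply: h2; exact: leq_maxr.
Qed.

Lemma Cn_holomorphic_cst (A : set X) (c : Y) : Cn_holomorphic A (fun=> c).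
Proof. by apply/Cn_holomorphicP => i; exact: holE_cst. Qed.

(* As z lies in the (p m.+1)-th compact set of the exhaustion, the later
   functions hardly change the value reached at z by the m-th partial sum. *)
Lemma peak_sequence (p0 : X) (xi : nat -> X) (b : nat -> R) : ~ U p0 ->
  Cn_holomorphically_convex U ->
  exists (hs : nat -> X -> Y) (p : nat -> nat),
   [/\ forall m, (p m < p m.+1)%N, forall m, Cn_holomorphic U (hs m),
       forall m w, exhaustion U (p m) w -> rn (hs m w) <= (1 / 2) ^+ m &
       forall m, U (xi m) -> exists z, [/\ inscribed_ball U (xi m) z,
         exhaustion U (p m.+1) z &
         b m < rn (\sum_(k < m.+1) hs k z)]].
Proof.
move=> np0 cvx.
have step (s : nat * (nat * (X -> Y))) : exists t : nat * (X -> Y),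
    [/\ (s.2.1 < t.1)%N, Cn_holomorphic U (fun w => t.2 w - s.2.2 w),
     forall w, exhaustion U s.2.1 w -> rn (t.2 w - s.2.2 w) <= (1 / 2) ^+ s.1 &
     U (xi s.1) -> exists z, [/\ inscribed_ball U (xi s.1) z,
       exhaustion U t.1 z & b s.1 < rn (t.2 z)]].
  case: s => m [p S] /=.
  have e0 : 0 < (1 / 2 : R) ^+ m by apply: exprn_gt0; lra.
  have [Ux|nUx] := pselect (U (xi m)); last first.
    exists (p.+1, S); split.
    - exact: ltnSn.
    - have -> : (fun w => S w - S w) = fun=> 0 by apply/funext => w; rewrite subrr.
      exact: Cn_holomorphic_cst.
    - by move=> w _; rewrite subrr rn0 ltW.
    - by move=> Ux; case: (nUx Ux).
  have cL := cvx _ (@exhaustion_compact _ _ U p) (@exhaustion_sub _ _ U p).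
  (* Convexity enters here: the hull is compact, so the inscribed ball has a point z outside it. *)
  have := inscribed_ball_noncompact oU Ux np0 cL (@hull_sub _ _ _ U (exhaustion U p)).
  move=> /existsNP[z /not_implyP[z1 z2]].
  have Uz := inscribed_ball_sub z1.
  (* The height compensates for the earlier sum S, which might cancel part of the peak at z. *)
  have [h [hH hK hz]] := Cn_peak (b m + rn (S z)) (@exhaustion_compact _ _ U p)
    (@exhaustion_sub _ _ U p) Uz z2 e0.
  have [r r0 [q hq]] := exhaustion_nbhs oU Uz.
  exists (maxn p.+1 q, fun w => S w + h w); split=> /=.
  - exact: leq_maxl.
  - by have -> : (fun w => S w + h w - S w) = h by apply/funext => w;
    rewrite addrAC subrr add0r.
  - by move=> w /hK; rewrite addrAC subrr add0r.
  move=> _; exists z; split=> //.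
    by apply: (exhaustion_mono (leq_maxr _ _)); apply: hq; exact: rnball_center.
  have := rnD (S z + h z) (- S z); rewrite rnN addrAC subrr add0r; lra.
have [g hg] := choice step.
pose st := fix st m : nat * (X -> Y) := if m is k.+1 then g (k, st k) else (0%N,
  fun=> 0).
pose hs m w := (st m.+1).2 w - (st m).2 w.
have sumE m w : \sum_(k < m) hs k w = (st m).2 w.
  elim: m => [|m IH]; first by rewrite big_ord0.
  by rewrite big_ord_recr /= IH /hs addrC subrK.
exists hs, (fun m => (st m).1); split=> m.
- by have [] := hg (m, st m).
- by have [] := hg (m, st m).
- by move=> w; have [_ _ + _] := hg (m, st m); apply.
- move=> Um; have [_ _ _ /(_ Um) [z [z1 z2 z3]]] := hg (m, st m).
  by exists z; split=> //; rewrite sumE.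
Qed.

Lemma unbounded_function (p0 : X) : ~ U p0 -> Cn_holomorphically_convex U ->
  exists2 f : X -> Y, Cn_holomorphic U f &
    forall (w : 'rV[(rat * rat)%type]_(\sum_(j < n) l j)) (B : R), U (ratpoint w) ->
    exists2 z, inscribed_ball U (ratpoint w) z & B <= rn (f z).
Proof.
move=> np0 cvx.
pose W := 'rV[(rat * rat)%type]_(\sum_(j < n) l j).
(* Enumerating pairs visits each rational point once for every height; numbers that code no pair get
   a default. *)
pose idx m : W * nat :=
  odflt (const_mx (0 : rat, 0 : rat), 0%N) (unpickle m : option (W * nat)%type).
have [hs [p [pm hH hK hz]]] := peak_sequence (fun m => ratpoint (idx m).1)
  (fun m => (idx m).2%:R + 1) np0 cvx.
have pge m : (m <= p m)%N.
  by elim: m => // m IH; exact: leq_ltn_trans IH (pm m).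
have pmono : {homo p : a b / (a <= b)%N}.
  by apply: homo_leq => // [|m]; [exact: leq_trans|exact: ltnW].
have hsi k i x : exhaustion U (p k) x -> rn (hs k x 0 i) <= (1 / 2) ^+ k * 1.
  by move=> /hK; rewrite mulr1; exact: le_trans (rn_coord_le _ _).
have ser i : exists g : X -> C, holE (other_block i) U g /\
    forall x, U x -> \sum_(k < m) hs k x 0 i @[m --> \oo] --> g x.
  have [||g] := @holE_series _ _ (other_block i) U (fun k x => hs k x 0 i) oU.
  - by move=> k; exact: (Cn_holomorphicP _ _).1 (hH k) i.
  - move=> a Ua; have [r r0 [m hm]] := exhaustion_nbhs oU Ua.
    exists r => //; exists m, 1 => k x mk /hm xm; apply: hsi.
    by apply: exhaustion_mono xm; exact: leq_trans mk (pge k).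
  by exists g.
have [g hg] := choice ser.
pose f z : Y := \row_i g i z.
exists f.
  apply/Cn_holomorphicP => i; have [gH _] := hg i.
  by apply: eq_holE gH => z; rewrite mxE.
move=> w B Uw.
pose j := (Num.truncn `|B|).+1.
pose m := pickle (w, j).
have im : idx m = (w, j) by rewrite /idx /m pickleK.
have := hz m; rewrite im /= => /(_ Uw)[z [z1 z2 z3]].
exists z => //.
have Uz := inscribed_ball_sub z1.
have jB : B <= j%:R.
  by apply: le_trans (ler_norm B) _; apply/ltW; exact: truncnS_gt.
pose S m' : Y := \sum_(k < m') hs k z.
have SE m' i : S m' 0 i = \sum_(k < m') hs k z 0 i by rewrite /S summxE.
(* The later terms change the value at z by at most 1, which the added 1 in the prescribed heights
   makes up for. *)
have tail d : rn (S (m.+1 + d)%N - S m.+1) <= (1 - (1 / 2) ^+ d).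
  elim: d => [|d IH]; first by rewrite addn0 subrr rn0 expr0 subrr.
  rewrite /S addnS big_ord_recr /= addrAC.
  apply: (le_trans (rnD (S (m.+1 + d)%N - S m.+1) (hs (m.+1 + d)%N z))).
  have h1 : rn (hs (m.+1 + d)%N z) <= (1 / 2) ^+ (m.+1 + d).
    by apply: hK; apply: exhaustion_mono z2; apply: pmono; exact: leq_addr.
  have h2 : (1 / 2 : R) ^+ (m.+1 + d) <= (1 / 2) ^+ d.+1.
    by apply: half_expn_le; rewrite addSnnS leq_addl.
  apply: le_trans (lerD IH (le_trans h1 h2)) _.
  exact: half_telescope.
have close : rn (f z - S m.+1) <= 1.
  apply/(rn_rV_le _ ler01) => i; rewrite /f !mxE.
  have [_ /(_ z Uz) gi] := hg i.
  have c : \sum_(k < m') hs k z 0 i - S m.+1 0 i @[m' --> \oo] --> g i z - S m.+1 0 i.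
    by apply: cvgB; [exact: gi|exact: cvg_cst].
  apply: (lim_rn_le (N := m.+1) c) => m' mm; rewrite -SE.
  have -> : S m' 0 i - S m.+1 0 i = (S m' - S m.+1) 0 i by rewrite !mxE.
  apply: le_trans (rn_coord_le _ _) _; rewrite -(subnKC mm).
  apply: le_trans (tail _) _.
  exact: half_expn_le1.
have := rnD (S m.+1 - f z) (f z); rewrite subrK (rnB _ (f z)) => h.
apply: le_trans jB _; move: (z3 : j%:R + 1 < rn (S m.+1)) h close.
exact: le_of_close.
Qed.

(** If g continued f, the set A where they agree locally would have a limit point p in V outside A.
    The identity theorem excludes p in U; otherwise g is bounded near p, while f is unbounded on
    inscribed balls close to p. *)
Lemma convex_existence : Cn_holomorphically_convex U -> domain_of_Cn_existence U.
Proof.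
move=> cvx; split=> //.
(* When U is the whole space no V leaves U, and any function will do. *)
have [UT|/existsNP[p0 np0]] := pselect (forall x, U x).
  exists (fun=> 0); first exact: Cn_holomorphic_cst.
  by move=> V W _ _ _ [x [_ []]].
have [f fH funb] := unbounded_function np0 cvx; exists f => //.
move=> V W oV oW cV [x0 [Vx0 nUx0]] [w0 Ww0] WUV g gH fg.
pose agree (D : set X) := forall y, D y -> f y = g y.
pose A := [set x | [/\ U x, V x & exists2 e : R, 0 < e & agree (rnball x e)]].
have oUV : open (U `&` V) by exact: openI.
have identity (D : set X) a : open D -> connected D -> D `<=` U `&` V -> D a -> A a ->
  agree D.
  move=> oD cD DUV Da [_ _ [e e0 he]] y Dy; apply/rowP => i.
  apply/eqP; rewrite -subr_eq0; apply/eqP.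
  have dH : holE (other_block i) D (fun x => f x 0 i - g x 0 i).
    apply: holEB.
      by apply: holE_sub ((Cn_holomorphicP _ _).1 fH i) => z /DUV[].
    by apply: holE_sub ((Cn_holomorphicP _ _).1 gH i) => z /DUV[].
  apply: (identity_theorem oD cD dH Da e0 _ Dy) => z /he ->.
  by rewrite subrr.
have AO a : A a -> exists2 e : R, 0 < e & rnball a e `<=` A.
  move=> [Ua Va [e e0 he]]; have [r r0 hr] := open_rnP oUV (conj Ua Va).
  exists (Num.min r (e / 2)); first by rewrite lt_min r0; lra.
  move=> x; rewrite /rnball /= lt_min => /andP[x1 x2].
  have [Ux Vx] := hr x x1; split=> //; exists (e / 2); first lra.
  by move=> y yx; apply: he; apply: (@rnball_sub _ _ a x e (e / 2)) yx; lra.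
(* Otherwise A would be open and closed in V, hence equal to V, although A lies in U. *)
have [p [Vp cp nA]] : exists p, [/\ V p, closure A p & ~ A p].
  apply: contrapT => H; apply: nUx0.
  suff VA : A = V by move: Vx0; rewrite -VA => -[].
  apply: cV.
  - have [Uw Vw] := WUV _ Ww0; have [e e0 he] := open_rnP oW Ww0.
    by exists w0; split=> //; exists e => // y /he; exact: fg.
  - exists A; last by apply/seteqP; split=> [x Ax|x [_ //]]; split=> //; case: Ax.
    by rewrite openE => x /AO[e e0 he]; apply/nbhs_rnP; exists e.
  - exists (closure A); first exact: closed_closure.
    apply/seteqP; split=> [x Ax|x [Vx cx]].
      by split; [case: Ax|exact: subset_closure].
    by apply: contrapT => nAx; apply: H; exists x.
have [Up|nUp] := pselect (U p).
  have [s s0 hs] := open_rnP oUV (conj Up Vp).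
  have [a [Aa ap]] := cp _ (nbhs_rnball p s0).
  apply: nA; split=> //; exists s => //.
  exact: (identity (rnball p s) a (open_rnball p s) (connected_rnball s0) hs ap Aa).
have [s1 s10 hs1] := open_rnP oV Vp.
have gc : {for p, continuous g} by apply: differentiable_continuous; exact: gH.1.
have /continuous_rnP/(_ _ ltr01)[s2 s20 hs2] := gc.
pose s := Num.min s1 s2.
have s0 : 0 < s by rewrite lt_min s10.
have sV x : rnball p s x -> V x /\ rn (g x) < rn (g p) + 1.
  rewrite /rnball /= lt_min => /andP[/hs1 Vx /hs2 h]; split=> //.
  have := rnD (g x - g p) (g p); rewrite subrK; lra.
(* A centre xi within s / 4 of p, which is not in U, has its inscribed ball inside the ball of
   radius s / 2 around p. *)
have s4 : 0 < s / 4 by lra.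
have [a [Aa ap]] := cp _ (nbhs_rnball p s4).
have [e e0 he] := AO a Aa.
pose d := Num.min e (s / 4 - rn (a - p)).
have d0 : 0 < d by rewrite lt_min e0 subr_gt0.
have [w hw] := ratpoint_dense a d0; set xi := ratpoint w in hw.
move: hw; rewrite lt_min => /andP[xa1 xa2].
have Axi : A xi by exact: he.
have xip : rn (xi - p) < s / 4 by have := rn_tri xi a p; lra.
have Uxi : U xi by case: Axi.
have inUV : inscribed_ball U xi `<=` U `&` rnball p s.
  move=> x xin; split; first exact: inscribed_ball_sub xin.
  have := inscribed_ball_dist nUp xin; rewrite /rnball /= => h.
  have := rn_tri x xi p; rewrite (rnB p) in h; lra.
have [z z1 z2] := funb w (rn (g p) + 1) Uxi.
have inscribed_UV : inscribed_ball U xi `<=` U `&` V by move=> x /inUV[Ux /sV[Vx _]].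
have fgz : f z = g z.
  exact: (identity _ xi (@inscribed_ball_open _ _ U xi) (@inscribed_ball_connected _ _
    U xi) inscribed_UV
    (inscribed_ball_center oU Uxi) Axi z z1).
have [_ /sV[_ h]] := inUV z z1.
by move: z2; rewrite fgz leNgt h.
Qed.

End Construction.

Theorem theorem8 (R : realType) (n : nat) (n_gt0 : (0 < n)%N)
    (l : 'I_n -> nat) (l_gt0 : forall j : 'I_n, (0 < l j)%N)
    (U : set (@blockspace R n l)) (U_open : open U) :
  (domain_of_Cn_existence U <-> domain_of_Cn_holomorphy U) /\
  (domain_of_Cn_holomorphy U <-> Cn_holomorphically_convex U).
Proof.
have ab := @existence_holomorphy R n l U.
have bc := @holomorphy_convex R n l U U_open.
have ca := @convex_existence R n l U U_open.
by split; split=> h; [exact: ab|exact: ca (bc h)|exact: bc|exact: ab (ca h)].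
Qed.
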